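(* Locally Rainbow Walk can be solved in $\mathcal{O}((r\cdot e)^{\omega r}\cdot \ell m)$ time, where $m$ is the number of arcs of the input digraph, $e$ is Euler's number and $\omega$ is the matrix multiplication exponent.
   Context: A digraph $G=(V,A)$ has $A\subseteq V\times V$ and no self-loops. A walk of length $q$ from $v$ to $w$ (a $v$-$w$ walk) is a sequence $(u_0=v,u_1,\dots,u_q=w)$ of vertices with $(u_{i-1},u_i)\in A$ for all $i\in\{1,\dots,q\}$; it is a path if its vertices are pairwise distinct. Given a vertex coloring $c\colon V\to C$ and an integer $r\ge 0$, a walk $(v_0,\dots,v_q)$ is $r$-rainbow if for every $i\in\{0,\dots,q-r\}$ the vertices $v_i,v_{i+1},\dots,v_{i+r}$ have pairwise different colors. Locally Rainbow Walk: given a digraph $G$, a vertex coloring $c\colon V(G)\to C$, two distinct vertices $s,t$, and integers $r,\ell\ge 0$, decide whether $G$ contains an $r$-rainbow $s$-$t$ walk of length at most $\ell$. Standing assumption: the input digraph is weakly connected (its underlying undirected graph is connected), so $n\le m+1$ where $n=|V|$, $m=|A|$. *)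

(* Defs.v *)
From HB Require Import structures.
From mathcomp Require Import all_boot all_order all_algebra.
From mathcomp Require Import all_classical all_reals all_analysis.

Set Implicit Arguments.
Unset Strict Implicit.
Unset Printing Implicit Defensive.

Import Order.TTheory GRing.Theory Num.Theory.

(** * Digraphs and locally rainbow walks *)

Record digraph := Digraph {
  nvert : nat;
  arcs : {set 'I_nvert * 'I_nvert};
  loopless : forall v, (v, v) \notin arcs
}.

Definition vertex (G : digraph) := 'I_(nvert G).

Definition arc (G : digraph) : rel (vertex G) := fun u v => (u, v) \in arcs G.

Definition weakly_connected (G : digraph) : Prop :=
  forall u v : vertex G, connect (fun x y => arc x y || arc y x) u v.

(* The walk (u_0, ..., u_q) is represented by its start [u_0] and the sequence
   [p = [:: u_1; ...; u_q]], so that its length is [size p]. *)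
Definition is_walk (G : digraph) (v w : vertex G) (p : seq (vertex G)) : Prop :=
  path (@arc G) v p /\ last v p = w.

(* [i + r <= q] rather than [i <= q - r]: when q < r the range of [i] is empty
   and the condition is vacuous, whereas [q - r] would be truncated to 0. *)
Definition rainbow (G : digraph) (c : vertex G -> nat) (r : nat)
    (v : vertex G) (p : seq (vertex G)) : Prop :=
  forall i, i + r <= size p -> uniq [seq c u | u <- take r.+1 (drop i (v :: p))].

Record lrw_instance := LRWInstance {
  graph : digraph;
  color : vertex graph -> nat;
  source : vertex graph;
  target : vertex graph;
  source_target : source != target;
  rainbow_param : nat;
  maxlen : nat
}.

Definition lrw_yes (I : lrw_instance) : Prop :=
  exists p : seq (vertex (graph I)),
    [/\ is_walk (source I) (target I) p,
        rainbow (@color I) (rainbow_param I) (source I) p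
      & size p <= maxlen I].

(* The arcs are listed in the order given by [e], an arbitrary enumeration of
   [arcs (graph I)]; algorithms have to be correct for every such order. *)
Definition lrw_encode (I : lrw_instance)
    (e : seq (vertex (graph I) * vertex (graph I))) : seq nat :=
  [:: nvert (graph I); #|arcs (graph I)|;
      val (source I); val (target I); rainbow_param I; maxlen I]
  ++ [seq color v | v <- enum 'I_(nvert (graph I))]
  ++ flatten [seq [:: val a.1; val a.2] | a <- e].

(** * Random access machines

   A program acts on registers, addressed by constants of the program, and on a
   memory, addressed by the contents of registers.  The input is stored in the
   first memory cells and every other cell and register is initially 0.  The
   machine halts when the program counter leaves the program, and accepts when
   register 0 is then nonzero.  Each instruction takes unit time; [word_bounded]
   excludes exploiting this with huge integers. *)

Inductive instr :=
| IConst of nat & nat           (* R[d] := k *)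
| IAdd of nat & nat & nat       (* R[d] := R[x] + R[y] *)
| ISub of nat & nat & nat       (* R[d] := R[x] - R[y], truncated at 0 *)
| IMul of nat & nat & nat       (* R[d] := R[x] * R[y] *)
| IDiv of nat & nat & nat       (* R[d] := R[x] %/ R[y] *)
| IRead of nat & nat            (* R[d] := M[R[x]] *)
| IWrite of nat & nat           (* M[R[x]] := R[y] *)
| IJump of nat & nat.           (* if R[x] = 0 then goto l *)

Definition program := seq instr.

Record config := Config { pc : nat; reg : nat -> nat; cell : nat -> nat }.

Definition exec (i : instr) (s : config) : config :=
  let: Config pc R M := s in
  let set_reg d v := Config pc.+1 [eta R with d |-> v] M in
  match i with
  | IConst d k => set_reg d k
  | IAdd d x y => set_reg d (R x + R y)
  | ISub d x y => set_reg d (R x - R y)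
  | IMul d x y => set_reg d (R x * R y)
  | IDiv d x y => set_reg d (R x %/ R y)
  | IRead d x => set_reg d (M (R x))
  | IWrite x y => Config pc.+1 R [eta M with R x |-> R y]
  | IJump x l => Config (if R x == 0 then l else pc.+1) R M
  end.

Definition step (P : program) (s : config) : config :=
  if onth P (pc s) is Some i then exec i s else s.

Definition init (inp : seq nat) : config :=
  Config 0 (fun _ => 0) (fun a => nth 0 inp a).

Definition run (P : program) (inp : seq nat) (k : nat) : config :=
  iter k (step P) (init inp).

Definition halted (P : program) (s : config) : Prop := size P <= pc s.

Definition accepting (s : config) : Prop := reg s 0 != 0.

(* During the first [t] steps only words of at most
   K * log2 (2 + t + sum of the input numbers) bits are used. *)
Definition word_bounded (K : nat) (P : program) (inp : seq nat) (t : nat) :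
    Prop :=
  forall k a, k <= t ->
    reg (run P inp k) a <= (2 + t + sumn inp) ^ K /\
    cell (run P inp k) a <= (2 + t + sumn inp) ^ K.

Definition decides_in (K : nat) (P : program) (inp : seq nat) (yes : Prop)
    (t : nat) : Prop :=
  [/\ halted P (run P inp t), accepting (run P inp t) <-> yes
    & word_bounded K P inp t].

(** * The matrix multiplication exponent *)

Local Open Scope ring_scope.

(* The instructions of a straight-line program; the numbers refer to the inputs
   and previously computed values, in this order.  Divisions are left out: they
   do not affect the exponent (Strassen). *)
Inductive arith_instr (F : Type) :=
| ACst of F
| AAdd of nat & nat
| ASub of nat & nat
| AMul of nat & nat.

Definition slp (F : Type) := seq (arith_instr F).

Definition arith_eval (F : fieldType) (L : comAlgType F) (vs : seq L)
    (o : arith_instr F) : L :=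
  match o with
  | ACst a => a%:A
  | AAdd i j => vs`_i + vs`_j
  | ASub i j => vs`_i - vs`_j
  | AMul i j => vs`_i * vs`_j
  end.

Definition slp_eval (F : fieldType) (L : comAlgType F) (vs : seq L)
    (p : slp F) : seq L :=
  foldl (fun vs o => rcons vs (arith_eval vs o)) vs p.

Definition mx_entries (T : Type) (n : nat) (A : 'M[T]_n) : seq T :=
  [seq A i j | i <- enum 'I_n, j <- enum 'I_n].

(* [L] ranges over all commutative F-algebras, in particular polynomial rings,
   so that the entries of the product are computed as polynomials in the entries
   of the factors and not merely as functions on F (which may be finite). *)
Definition computes_mulmx (F : fieldType) (n : nat) (p : slp F) : Prop :=
  exists out : 'I_n -> 'I_n -> nat,
    forall (L : comAlgType F) (A B : 'M[L]_n) (i j : 'I_n),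
      (slp_eval (mx_entries A ++ mx_entries B) p)`_(out i j) = (A *m B) i j.

Definition mulmx_exponent (R : realType) (F : fieldType) : R :=
  inf [set tau : R | exists K : R, forall n : nat, (0 < n)%N ->
        exists2 p : slp F, computes_mulmx n p & (size p)%:R <= K * n%:R `^ tau]%classic.

(* The summand 1 only matters when maxlen I = 0, where the product vanishes. *)
Definition lrw_bound (R : realType) (omega : R) (I : lrw_instance) : R :=
  1 + ((rainbow_param I)%:R * expR 1) `^ (omega * (rainbow_param I)%:R)
      * ((maxlen I)%:R * #|arcs (graph I)|%:R).

(* Main.v *)
(* Since the n^2 entries of a matrix product must be computed separately, the
   exponent omega is at least 2, and it suffices to give an algorithm running in
   time O((r e)^(2 r) l m); no matrix multiplication is needed.  If the walk has
   length at least r, being r-rainbow means that any two vertices at distance at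
   most r differ in color, so whether a walk can be extended depends only on its
   window of the last r vertices.  For every length q and vertex v the windows
   of the walks of length q from s to v are replaced by representatives arranged
   in an r^2-ary tree of depth r.  Each node carries partial information on the
   next r vertices after v and is labelled with a window that is compatible with
   it, if there is one.  To find a window compatible with a given future, start
   at the root; if the label conflicts with the future at positions (i, j), the
   child (i, j), which knows the color at position j, is consulted next.  Every
   step determines a new position of the future, so r steps suffice.  The labels
   for length q + 1 are found by such queries, one per node and arc, in time
   O(r^3) each; and a tree has at most (r + 1) r^(2 r) nodes, where the factor
   e^(2 r) absorbs the polynomial overhead.  The algorithm is written in a small
   language of counted loops that is compiled to random access machines. *)

Require Import Defs.
From HB Require Import structures.
From mathcomp Require Import all_boot all_order all_algebra.
From mathcomp Require Import all_classical all_reals all_analysis.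
From mathcomp Require Import zify lra.

Set Implicit Arguments.
Unset Strict Implicit.
Unset Printing Implicit Defensive.

Import Order.TTheory GRing.Theory Num.Theory.

(** * A compiled language of counted loops *)

(** What has to be exact is the absence of a label: an unlabelled node certifies that every window
    conflicts with its assumptions. A query ending there inherits this for the actual future,
    because conflicts persist when more colors become known. The future of a child contains a vertex
    of its parent's label, so that label must be final before the child is treated: in each layer
    the loop over nodes encloses the loop over arcs. While the arcs are processed a label may be
    overwritten, any compatible window being as good as another. Words may be polynomial in the
    running time, so the number of nodes fits into one. If l = 0, only constant time is allowed, too
    little even for counting the nodes, and the algorithm stops at once. Otherwise the connectedness
    and s != t give m > 0, so that the main term dominates all overheads. *)

Inductive binop := OAdd | OSub | OMul | ODiv | OMin.

Inductive expr :=
| Cst of nat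
| Var of nat
| Bin of binop & expr & expr
| Rd of expr.

Inductive cmd :=
| Asg of nat & expr
| Wr of expr & expr
| Seq of cmd & cmd
| If of expr & cmd
| For of nat & nat & cmd.

Record state := State { var : nat -> nat; ram : nat -> nat }.

Definition upd (f : nat -> nat) (x v : nat) : nat -> nat :=
  fun y => if y == x then v else f y.

Definition set_var (s : state) (x v : nat) : state :=
  State (upd (var s) x v) (ram s).

Definition bin (o : binop) : nat -> nat -> nat :=
  match o with
  | OAdd => addn
  | OSub => subn
  | OMul => muln
  | ODiv => divn
  | OMin => minn
  end.

Fixpoint eval (e : expr) (s : state) : nat :=
  match e with
  | Cst k => k
  | Var x => var s x
  | Bin o e1 e2 => bin o (eval e1 s) (eval e2 s)
  | Rd e1 => ram s (eval e1 s)
  end.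

Definition loop_body (i : nat) (f : state -> state) (s : state) : state :=
  let s' := f s in set_var s' i (var s' i).+1.

Fixpoint den (c : cmd) (s : state) : state :=
  match c with
  | Asg x e => set_var s x (eval e s)
  | Wr e1 e2 => State (var s) (upd (ram s) (eval e1 s) (eval e2 s))
  | Seq c1 c2 => den c2 (den c1 s)
  | If e c1 => if eval e s == 0 then s else den c1 s
  | For i x c1 => iter (var s x) (loop_body i (den c1)) (set_var s i 0)
  end.

Definition loop_state (i : nat) (c : cmd) (k : nat) (s : state) : state :=
  iter k (loop_body i (den c)) (set_var s i 0).

(* Registers from [tmp] on hold intermediate results, those below are the
   variables. *)
Definition tmp := 40.

(** With truncated subtraction, min(a, b) = a - (a - b). *)
Definition bin_code (o : binop) (t : nat) : program :=
  match o with
  | OAdd => [:: IAdd t t t.+1]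
  | OSub => [:: ISub t t t.+1]
  | OMul => [:: IMul t t t.+1]
  | ODiv => [:: IDiv t t t.+1]
  | OMin => [:: ISub t.+1 t t.+1; ISub t t t.+1]
  end.

(** Evaluation on a stack of registers: the value ends up in [t] and no register below [t] changes,
    so the first operand survives the evaluation of the second. *)
Fixpoint comp_expr (e : expr) (t : nat) : program :=
  match e with
  | Cst k => [:: IConst t k]
  | Var x => [:: IConst t 0; IAdd t x t]
  | Bin o e1 e2 => comp_expr e1 t ++ comp_expr e2 t.+1 ++ bin_code o t
  | Rd e1 => comp_expr e1 t ++ [:: IRead t t]
  end.

(** Jumps are absolute, hence the address [o] of the first instruction. The jump closing a loop
    tests a register just set to 0, which makes it unconditional. *)
Fixpoint compile (c : cmd) (o : nat) : program :=
  match c with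
  | Asg x e => comp_expr e tmp ++ [:: IConst tmp.+1 0; IAdd x tmp tmp.+1]
  | Wr e1 e2 => comp_expr e1 tmp ++ comp_expr e2 tmp.+1 ++ [:: IWrite tmp tmp.+1]
  | Seq c1 c2 => let p := compile c1 o in p ++ compile c2 (o + size p)
  | If e c1 =>
      let pe := comp_expr e tmp in
      let p := compile c1 (o + size pe).+1 in
      pe ++ IJump tmp ((o + size pe).+1 + size p) :: p
  | For i x c1 =>
      let p := compile c1 (o + 3) in
      [:: IConst i 0; ISub tmp x i; IJump tmp (o + 3 + size p + 4)] ++ p
      ++ [:: IConst tmp 1; IAdd i i tmp; IConst tmp 0; IJump tmp o.+1]
  end.

(** In a loop, 3 counts the initialization and the last test, 6 the test, the increment and the jump
    back of each iteration. *)
Fixpoint cost (c : cmd) (s : state) : nat :=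
  match c with
  | Asg _ e => size (comp_expr e tmp) + 2
  | Wr e1 e2 => size (comp_expr e1 tmp) + size (comp_expr e2 tmp.+1) + 1
  | Seq c1 c2 => cost c1 s + cost c2 (den c1 s)
  | If e c1 => (size (comp_expr e tmp)).+1 + (if eval e s == 0 then 0 else cost c1 s)
  | For i x c1 => 3 + \sum_(k < var s x) (cost c1 (loop_state i c1 k s) + 6)
  end.

Fixpoint assigned (c : cmd) : seq nat :=
  match c with
  | Asg x _ => [:: x]
  | Wr _ _ => [::]
  | Seq c1 c2 => assigned c1 ++ assigned c2
  | If _ c1 => assigned c1
  | For i _ c1 => i :: assigned c1
  end.

Fixpoint ewf (e : expr) : bool :=
  match e with
  | Cst _ => true
  | Var x => x < tmp
  | Bin _ e1 e2 => ewf e1 && ewf e2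
  | Rd e1 => ewf e1
  end.

(** The machine compares counter and limit anew before each iteration, whereas [den] fixes the
    number of iterations on entry. They agree because the body assigns neither of the two. *)
Fixpoint wf (c : cmd) : bool :=
  match c with
  | Asg x e => (x < tmp) && ewf e
  | Wr e1 e2 => ewf e1 && ewf e2
  | Seq c1 c2 => wf c1 && wf c2
  | If e c1 => ewf e && wf c1
  | For i x c1 => [&& i < tmp, x < tmp, x != i, i \notin assigned c1, x \notin assigned c1 & wf c1]
  end.

Fixpoint esafe (W : nat) (e : expr) (s : state) : Prop :=
  eval e s <= W /\
  match e with
  | Cst _ | Var _ => True
  | Bin _ e1 e2 => esafe W e1 s /\ esafe W e2 s
  | Rd e1 => esafe W e1 s
  end.

(** Loop counters need no condition: they never exceed the limit, which is itself the content of a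
    register. *)
Fixpoint safe (W : nat) (c : cmd) (s : state) : Prop :=
  match c with
  | Asg _ e => esafe W e s
  | Wr e1 e2 => esafe W e1 s /\ esafe W e2 s
  | Seq c1 c2 => safe W c1 s /\ safe W c2 (den c1 s)
  | If e c1 => esafe W e s /\ (eval e s != 0 -> safe W c1 s)
  | For i x c1 => forall k, k < var s x -> safe W c1 (loop_state i c1 k s)
  end.

Lemma var_den c s x : x \notin assigned c -> var (den c s) x = var s x.
Proof.
elim: c s => [y e|e1 e2|c1 IH1 c2 IH2|e c IH|i y c IH] s //=.
- by rewrite inE /upd => /negbTE->.
- by rewrite mem_cat negb_or => /andP[h1 h2]; rewrite IH2 // IH1.
- by case: ifP => // _; exact: IH.
- rewrite inE negb_or => /andP[/negbTE hx hc].
  elim: (var s y) => [|k IHk] /=; first by rewrite /upd hx.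
  by rewrite {1}/upd hx IH.
Qed.

Lemma var_loop_state i c k s x : x != i -> x \notin assigned c ->
  var (loop_state i c k s) x = var s x.
Proof.
move=> /negbTE hx hc; elim: k => [|k IHk] /=; first by rewrite /upd hx.
by rewrite {1}/upd hx var_den.
Qed.

Lemma loop_state_index i c k s : i \notin assigned c -> var (loop_state i c k s) i = k.
Proof.
move=> hi; elim: k => [|k IHk] /=; first by rewrite /upd eqxx.
by rewrite {1}/upd eqxx var_den // IHk.
Qed.

(** * Correctness of the compiler *)

Section Machine.

Variables (P : program) (W : nat).

Definition bnd (s : config) := forall a, reg s a <= W /\ cell s a <= W.

(** The bound covers all configurations on the way, since [word_bounded] restricts every step of a
    run. *)
Definition reach (k : nat) (s s' : config) :=
  iter k (step P) s = s' /\ forall j, j <= k -> bnd (iter j (step P) s).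

Lemma reach_trans k1 k2 s1 s2 s3 :
  reach k1 s1 s2 -> reach k2 s2 s3 -> reach (k1 + k2) s1 s3.
Proof.
move=> [e1 b1] [e2 b2]; split; first by rewrite addnC iterD e1.
move=> j hj; have [le|lt] := leqP j k1; first exact: b1.
rewrite -(subnK (ltnW lt)) iterD e1; apply: b2; lia.
Qed.

Lemma reach_bnd k s s' : reach k s s' -> bnd s'.
Proof. by case=> <-; apply. Qed.

Lemma reach1 s i s' : onth P (pc s) = Some i -> exec i s = s' -> bnd s -> bnd s' ->
  reach 1 s s'.
Proof.
move=> hi he b b'; have e : step P s = s' by rewrite /step hi.
by split=> // -[|[|j]] // _; rewrite /= e.
Qed.

Definition code (o : nat) (p : program) :=
  exists p1 p2, P = p1 ++ p ++ p2 /\ size p1 = o.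

Lemma code_cat o p q : code o (p ++ q) -> code o p /\ code (o + size p) q.
Proof.
move=> [p1 [p2 [hP <-]]]; split; first by exists p1, (q ++ p2); rewrite hP -catA.
by exists (p1 ++ p), p2; rewrite size_cat hP !catA.
Qed.

Lemma code_cons o i q : code o (i :: q) -> onth P o = Some i /\ code o.+1 q.
Proof.
move=> [p1 [p2 [hP <-]]]; split.
  by rewrite hP onthE map_cat nth_cat size_map ltnn subnn.
by exists (rcons p1 i), p2; rewrite size_rcons hP cat_rcons.
Qed.

Definition sim (s : config) (g : state) :=
  (forall x, x < tmp -> reg s x = var g x) /\ (forall a, cell s a = ram g a).

Lemma bnd_set d v pc0 s : bnd s -> v <= W ->
  bnd (Config pc0 [eta reg s with d |-> v] (cell s)).
Proof.
by move=> b hv a /=; split; [case: eqP => // _; apply: (b a).1|apply: (b a).2].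
Qed.

Lemma reach_set d v s i : onth P (pc s) = Some i ->
  exec i s = Config (pc s).+1 [eta reg s with d |-> v] (cell s) ->
  bnd s -> v <= W ->
  reach 1 s (Config (pc s).+1 [eta reg s with d |-> v] (cell s)).
Proof. by move=> hi he b hv; apply: (reach1 hi he b _); apply: bnd_set. Qed.

Definition expr_post t (s : config) (v : nat) (k : nat) (s' : config) :=
  [/\ reach k s s', pc s' = pc s + k, reg s' t = v,
      forall x, x < t -> reg s' x = reg s x & cell s' = cell s].

Lemma expr_post_trans t s v k s' t' v' k' s'' : t <= t' ->
  expr_post t s v k s' -> expr_post t' s' v' k' s'' ->
  expr_post t s (reg s'' t) (k + k') s''.
Proof.
move=> htt [r hpc hv hx hc] [r' hpc' hv' hx' hc']; split=> //.
- exact: reach_trans r r'.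
- by rewrite hpc' hpc addnA.
- by move=> x hxt; rewrite hx' ?hx //; apply: leq_trans htt.
- by rewrite hc' hc.
Qed.

Lemma expr_post_set t s v' i : bnd s -> v' <= W ->
  onth P (pc s) = Some i ->
  exec i s = Config (pc s).+1 [eta reg s with t |-> v'] (cell s) ->
  expr_post t s v' 1 (Config (pc s).+1 [eta reg s with t |-> v'] (cell s)).
Proof.
move=> b hv' hi he; split=> //=.
- exact: reach_set hi he b hv'.
- by rewrite addn1.
- by rewrite eqxx.
- by move=> x hxt; rewrite ltn_eqF.
Qed.

Lemma sim_expr_post t s v k s' g : tmp <= t -> sim s g -> expr_post t s v k s' -> sim s' g.
Proof.
move=> ht [h1 h2] [_ _ _ hx hc]; split=> [x hxt|a]; last by rewrite hc.
by rewrite hx ?h1 //; apply: leq_trans ht.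
Qed.

Lemma expr_post_bnd t s v k s' : expr_post t s v k s' -> bnd s'.
Proof. by case=> /reach_bnd. Qed.

Lemma bin_code_correct o t s : bnd s -> code (pc s) (bin_code o t) ->
  bin o (reg s t) (reg s t.+1) <= W ->
  exists s', expr_post t s (bin o (reg s t) (reg s t.+1)) (size (bin_code o t)) s'.
Proof.
have neq : (t == t.+1) = false by rewrite ltn_eqF.
case: o => b hc hv; last first.
  move/code_cons: hc => [h /code_cons[h' _]].
  set v := reg s t - reg s t.+1.
  have hvW : v <= W by apply: leq_trans (leq_subr _ _) (b t).1.
  have r1 : reach 1 s (Config (pc s).+1 [eta reg s with t.+1 |-> v] (cell s)).
    by apply: (reach_set h _ b hvW); rewrite /v; case: (s).
  have [||r2 e2 e3 e4 e5] := @expr_post_set t _ (minn (reg s t) (reg s t.+1)) _ (reach_bnd r1) _ h' _ => //=.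
    by rewrite eqxx neq minnE.
  eexists; split; [exact: reach_trans r1 r2|by rewrite e2 /= addSn addn1 addn2|exact: e3| |by rewrite e5].
  by move=> x hx; rewrite e4 //= ltn_eqF // ltnW.
all: by move/code_cons: hc => [h _]; eexists; apply: (expr_post_set b hv h _); case: (s).
Qed.

Lemma comp_expr_correct e t s g : tmp <= t -> bnd s -> sim s g -> ewf e ->
  code (pc s) (comp_expr e t) -> esafe W e g ->
  exists s', expr_post t s (eval e g) (size (comp_expr e t)) s'.
Proof.
elim: e t s => [k|x|o e1 IH1 e2 IH2|e1 IH1] t s ht b hs /=.
- move=> _ /code_cons[h _] [hk _].
  by eexists; apply: expr_post_set h _ => //; case: (s).
- move=> hx /code_cons[h /code_cons[h' _]] [hk _].
  have p1 : expr_post t s 0 1 (Config (pc s).+1 [eta reg s with t |-> 0] (cell s)).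
    by apply: expr_post_set h _ => //; case: (s).
  have b1 := expr_post_bnd p1; set s1 := Config _ _ _ in p1 b1.
  have p2 : expr_post t s1 (var g x) 1 (Config (pc s1).+1 [eta reg s1 with t |-> var g x] (cell s1)).
    apply: (@expr_post_set _ s1 _ _ b1 hk h') => /=.
    by rewrite eqxx addn0 ltn_eqF ?hs.1 //; apply: leq_trans ht.
  have := expr_post_trans (leqnn t) p1 p2; have [_ _ -> _ _] := p2.
  by move=> p3; eexists; exact: p3.
- move=> /andP[w1 w2] /code_cat[c1 /code_cat[c2 c3]] [hk [f1 f2]].
  have [s1 p1] := IH1 _ _ ht b hs w1 c1 f1.
  have hpc1 : pc s1 = pc s + size (comp_expr e1 t) by case: p1.
  rewrite -hpc1 in c2 c3.
  have hs1 := sim_expr_post ht hs p1.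
  have [s2 p2] := IH2 _ _ (leqW ht) (expr_post_bnd p1) hs1 w2 c2 f2.
  have hpc2 : pc s2 = pc s1 + size (comp_expr e2 t.+1) by case: p2.
  rewrite -hpc2 in c3.
  have ev1 : reg s2 t = eval e1 g by have [_ _ _ -> //] := p2; case: p1.
  have ev2 : reg s2 t.+1 = eval e2 g by case: p2.
  have := bin_code_correct (expr_post_bnd p2) c3; rewrite ev1 ev2 => /(_ hk)[s3 p3].
  have p12 := expr_post_trans (leqnSn t) p1 p2.
  have := expr_post_trans (leqnn t) p12 p3; have [_ _ -> _ _] := p3.
  by rewrite !size_cat addnA => p; exists s3.
- move=> w1 /code_cat[c1 c2] [hk f1].
  have [s1 p1] := IH1 _ _ ht b hs w1 c1 f1.
  have [_ hpc1 ev1 _ hc1] := p1; rewrite -hpc1 in c2.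
  case/code_cons: c2 => h _.
  have p2 : expr_post t s1 (ram g (eval e1 g)) 1
     (Config (pc s1).+1 [eta reg s1 with t |-> ram g (eval e1 g)] (cell s1)).
    apply: expr_post_set h _ => //; first exact: expr_post_bnd p1.
    by rewrite -hs.2 -ev1 -hc1; case: (s1).
  have := expr_post_trans (leqnn t) p1 p2; have [_ _ -> _ _] := p2.
  by rewrite size_cat => p; eexists; exact: p.
Qed.

Lemma sim_set s g x v pc0 : sim s g ->
  sim (Config pc0 [eta reg s with x |-> v] (cell s)) (set_var g x v).
Proof.
move=> [h1 h2]; split=> [y hy|a] /=; last exact: h2.
by rewrite /upd; case: eqP => // _; apply: h1.
Qed.

Lemma sim_set_tmp s g x v pc0 : tmp <= x -> sim s g ->
  sim (Config pc0 [eta reg s with x |-> v] (cell s)) g.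
Proof.
move=> hx [h1 h2]; split=> [y hy|a] /=; last exact: h2.
by rewrite ltn_eqF ?h1 //; apply: leq_trans hx.
Qed.

Lemma esafe_le e g : esafe W e g -> eval e g <= W.
Proof. by case: e => /= *; firstorder. Qed.

Lemma compile_correct c s g : bnd s -> sim s g -> wf c -> 0 < W ->
  code (pc s) (compile c (pc s)) -> safe W c g ->
  exists s', [/\ reach (cost c g) s s', pc s' = pc s + size (compile c (pc s))
                & sim s' (den c g)].
Proof.
move=> b hs + W0; elim: c s g b hs => [x e|e1 e2|c1 IH1 c2 IH2|e c IH|i x c IH] s g b hs /=.
- move=> /andP[hx we] /code_cat[c1 c2] f.
  have [s1 p1] := comp_expr_correct (leqnn _) b hs we c1 f.
  have [r1 hpc1 ev1 hx1 hc1] := p1; rewrite -hpc1 in c2.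
  case/code_cons: c2 => h /code_cons[h' _].
  have hs1 := sim_expr_post (leqnn _) hs p1.
  set s2 := Config (pc s1).+1 [eta reg s1 with tmp.+1 |-> 0] (cell s1).
  have r2 : reach 1 s1 s2.
    by apply: (@reach_set tmp.+1 0 s1 _ h _ (reach_bnd r1) (leq0n _)); case: (s1).
  have r3 : reach 1 s2 (Config (pc s2).+1 [eta reg s2 with x |-> eval e g] (cell s2)).
    apply: (@reach_set _ _ s2 _ h' _ (reach_bnd r2) (esafe_le f)).
    by rewrite /= addn0 ev1.
  eexists; split.
  + by rewrite -[2]/(1 + 1); apply: reach_trans r1 (reach_trans r2 r3).
  + by rewrite /= hpc1 size_cat /= addn2 addnS addnS.
  + by apply: sim_set; apply: sim_set_tmp.
- move=> /andP[w1 w2] /code_cat[c1 /code_cat[c2 c3]] [f1 f2].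
  have [s1 p1] := comp_expr_correct (leqnn _) b hs w1 c1 f1.
  have [r1 hpc1 ev1 hx1 hc1] := p1; rewrite -hpc1 in c2 c3.
  have hs1 := sim_expr_post (leqnn _) hs p1.
  have [s2 p2] := comp_expr_correct (leqnSn _) (reach_bnd r1) hs1 w2 c2 f2.
  have [r2 hpc2 ev2 hx2 hc2] := p2; rewrite -hpc2 in c3.
  have hs2 := sim_expr_post (leqnSn _) hs1 p2.
  case/code_cons: c3 => h _.
  have b2 := reach_bnd r2.
  have r3 : reach 1 s2 (Config (pc s2).+1 (reg s2) [eta cell s2 with eval e1 g |-> eval e2 g]).
    apply: (reach1 h _ b2 _); first by rewrite -ev1 -ev2 -hx2 //; case: (s2).
    move=> a /=; split; first exact: (b2 a).1.
    by case: eqP => // _; [apply: esafe_le|apply: (b2 a).2].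
  eexists; split.
  + by rewrite -addnA; apply: reach_trans r1 (reach_trans r2 r3).
  + by rewrite /= hpc2 hpc1 !size_cat /=; lia.
  + split=> [y hy|a] /=; first by case: hs2 => ->.
    by rewrite /upd; case: eqP => // _; apply: hs2.2.
- move=> /andP[w1 w2] /code_cat[c1' c2'] [f1 f2].
  have [s1 [r1 hpc1 hs1]] := IH1 _ _ b hs w1 c1' f1.
  rewrite -hpc1 in c2' *.
  have [s2 [r2 hpc2 hs2]] := IH2 _ _ (reach_bnd r1) hs1 w2 c2' f2.
  exists s2; split=> //; first exact: reach_trans r1 r2.
  by rewrite hpc2 size_cat hpc1 addnA.
- move=> /andP[we wc] /code_cat[c1 c2] [f1 f2].
  have [s1 p1] := comp_expr_correct (leqnn _) b hs we c1 f1.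
  have [r1 hpc1 ev1 hx1 hc1] := p1; rewrite -hpc1 in c2 *.
  have hs1 := sim_expr_post (leqnn _) hs p1.
  case/code_cons: c2 => h c2.
  set tgt := (pc s1).+1 + _ in h *.
  have b1 := reach_bnd r1.
  have r2 : reach 1 s1 (Config (if eval e g == 0 then tgt else (pc s1).+1) (reg s1) (cell s1)).
    apply: (reach1 h _ b1 _); last by move=> a; exact: b1.
    by rewrite -ev1; case: (s1).
  case: eqP f2 r2 => [e0 _ r2|_ /(_ isT) f2 r2].
    eexists; split.
    + by rewrite addn0 -addn1; apply: reach_trans r1 r2.
    + by rewrite /= /tgt size_cat /= hpc1 !addnS addnA.
    + by case: hs1.
  set s2 := Config _ _ _ in r2.
  have [s3 [r3 hpc3 hs3]] : exists s3, [/\ reach (cost c g) s2 s3,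
      pc s3 = pc s2 + size (compile c (pc s2)) & sim s3 (den c g)].
    by apply: IH => //; exact: reach_bnd r2.
  exists s3; split=> //.
  + by rewrite -addn1 -addnA; apply: reach_trans r1 (reach_trans r2 r3).
  + by rewrite hpc3 /= size_cat /= hpc1 !addnS addnA.
- move=> /andP[hi /andP[hx /and4P[hxi hic hxc wc]]] /code_cons[h0 /code_cons[h1 /code_cons[h2]]].
  rewrite -addn3 => /code_cat[c1 /code_cons[h3 /code_cons[h4 /code_cons[h5 /code_cons[h6 _]]]]] f.
  set tgt := pc s + 3 + _ + 4 in h2 *.
  (* The configurations about to test the loop condition after [k] complete iterations. *)
  pose head (s' : config) k := [/\ bnd s', pc s' = (pc s).+1 & sim s' (loop_state i c k g)].
  have hix : i < tmp by [].
  set s1 := Config (pc s).+1 [eta reg s with i |-> 0] (cell s).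
  have r1 : reach 1 s s1 by apply: (@reach_set _ _ s _ h0 _ b (leq0n _)); case: (s).
  have hd1 : head s1 0 by split; [exact: reach_bnd r1| |exact: sim_set].
  have test s' k : head s' k -> k <= var g x ->
    exists s'', [/\ reach 2 s' s'', pc s'' = (if var g x - k == 0 then tgt else pc s + 3)
       & sim s'' (loop_state i c k g)].
    move=> [b' hpc' hs'] hk.
    rewrite -hpc' in h1.
    have e1 : reg s' x = var g x by rewrite hs'.1 // var_loop_state.
    have e2 : reg s' i = k by rewrite hs'.1 // loop_state_index.
    have q1 : reach 1 s' (Config (pc s').+1 [eta reg s' with tmp |-> var g x - k] (cell s')).
      apply: (@reach_set _ _ s' _ h1 _ b' _); first by rewrite -e1 -e2; case: (s').
      by rewrite -e1; apply: leq_trans (leq_subr _ _) (b' x).1.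
    set s2 := Config _ _ _ in q1.
    have hp2 : pc s2 = (pc s).+2 by rewrite /s2 /= hpc'.
    rewrite -hp2 in h2.
    have q2 : reach 1 s2 (Config (if var g x - k == 0 then tgt else (pc s2).+1) (reg s2) (cell s2)).
      by apply: (@reach1 s2 _ _ h2 _ (reach_bnd q1) _); [|move=> a; exact: (reach_bnd q1)].
    eexists; split; first exact: (reach_trans q1 q2).
      by rewrite /= hpc' addn3.
    by have [] := sim_set_tmp (x := tmp) (var g x - k) (pc s2) (leqnn _) hs'.
  have loop k : k <= var g x -> exists s', reach (1 + \sum_(j < k) (cost c (loop_state i c j g) + 6)) s s'
      /\ head s' k.
    elim: k => [|k IHk] hk; first by exists s1; rewrite big_ord0 addn0.
    have [s' [r' hd']] := IHk (ltnW hk).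
    have [s2 [q2 hp2 hs2]] := test _ _ hd' (ltnW hk).
    have nz : (var g x - k == 0) = false by apply/negbTE; rewrite subn_eq0 -ltnNge.
    rewrite nz in hp2.
    have [s3 [q3 hp3 hs3]] : exists s3, [/\ reach (cost c (loop_state i c k g)) s2 s3,
      pc s3 = pc s2 + size (compile c (pc s2)) & sim s3 (den c (loop_state i c k g))].
      by apply: IH => //; [exact: reach_bnd q2|rewrite hp2|apply: f].
    rewrite hp2 in hp3; rewrite -hp3 in h3 h4 h5 h6.
    set s4 := Config (pc s3).+1 [eta reg s3 with tmp |-> 1] (cell s3).
    have q4 : reach 1 s3 s4 by apply: (@reach_set _ _ s3 _ h3 _ (reach_bnd q3) W0); case: (s3).
    have ei : reg s3 i = k by rewrite hs3.1 // var_den // loop_state_index.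
    have ex : reg s3 x = var g x by rewrite hs3.1 // var_den // var_loop_state.
    set s5 := Config (pc s4).+1 [eta reg s4 with i |-> k.+1] (cell s4).
    have q5 : reach 1 s4 s5.
      apply: (@reach_set i k.+1 s4 (IAdd i i tmp) h4 _ (reach_bnd q4) _).
        by rewrite /= ltn_eqF // ei addn1.
      by apply: leq_trans hk _; rewrite -ex; exact: (reach_bnd q3 x).1.
    set s6 := Config (pc s5).+1 [eta reg s5 with tmp |-> 0] (cell s5).
    have q6 : reach 1 s5 s6 by apply: ((@reach_set tmp 0 s5 (IConst tmp 0) h5 _ (reach_bnd q5) (leq0n _))).
    set s7 := Config (pc s).+1 (reg s6) (cell s6).
    have q7 : reach 1 s6 s7 by apply: (@reach1 s6 _ s7 h6 _ (reach_bnd q6) _); [|move=> a; exact: (reach_bnd q6)].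
    exists s7; split.
      rewrite big_ord_recr /= addnA; apply: reach_trans r' _.
      have -> : cost c (loop_state i c k g) + 6 = 2 + (cost c (loop_state i c k g) + (1 + (1 + (1 + 1)))) by lia.
      do ![apply: reach_trans; [eassumption|]]; exact: q7.
    split; [exact: reach_bnd q7|by []|].
    have -> : loop_state i c k.+1 g = set_var (den c (loop_state i c k g)) i k.+1.
      by rewrite /loop_state /= /loop_body -/(loop_state i c k g) var_den // loop_state_index.
    rewrite /s7 /s6 /s5 /s4; split=> [y hy|a] /=; last exact: hs3.2.
    by rewrite (ltn_eqF hy) /upd; case: eqP => // _; apply: hs3.1.
  have [s2 [r2 hd2]] := loop _ (leqnn _).
  have [s3 [r3 hp3 hs3]] := test _ _ hd2 (leqnn _).
  rewrite subnn eqxx in hp3.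
  exists s3; split=> //.
  + have -> : 3 + \sum_(k < var g x) (cost c (loop_state i c k g) + 6) = 1 + \sum_(k < var g x) (cost c (loop_state i c k g) + 6) + 2 by lia.
    exact: reach_trans r2 r3.
  + by rewrite hp3 /tgt size_cat /=; lia.
Qed.

End Machine.

(** A halted machine does not move any more, so it suffices that [t] bounds the cost from above. *)
Lemma compile_decides (K : nat) (c : cmd) (inp : seq nat) (yes : Prop) (t : nat)
    (g := State (fun=> 0) (fun a => nth 0 inp a)) :
  wf c -> safe ((2 + t + sumn inp) ^ K) c g -> cost c g <= t ->
  (var (den c g) 0 != 0 <-> yes) ->
  0 < K ->
  decides_in K (compile c 0) inp yes t.
Proof.
move=> hwf hs ht hyes K0; set W := _ ^ K in hs.
have W0 : 0 < W by rewrite expn_gt0.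
have le_sum a : nth 0 inp a <= W.
  have h : nth 0 inp a <= sumn inp.
    elim: inp a {g hs ht hyes W W0} => [|x s IH] [|a] //=; first exact: leq_addr.
    by apply: leq_trans (IH a) _; apply: leq_addl.
  apply: leq_trans h (leq_trans (leq_addl (2 + t) _) _).
  by rewrite -{1}[2 + t + _]expn1 leq_pexp2l.
have b0 : bnd W (init inp) by move=> a /=.
have s0 : sim (init inp) g by split.
have c0 : code (compile c 0) (pc (init inp)) (compile c (pc (init inp))).
  by exists [::], [::]; rewrite cats0.
have [s' [[hr hb] hpc hs']] := compile_correct b0 s0 hwf W0 c0 hs.
have st j : iter j (step (compile c 0)) s' = s'.
  elim: j => //= j ->; rewrite /step onthE nth_default // size_map hpc /= add0n leqnn //.
have rn j : cost c g <= j -> run (compile c 0) inp j = s'.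
  by move=> hj; rewrite /run -(subnK hj) iterD hr st.
split; first by rewrite rn // /halted hpc.
  by rewrite rn // /accepting hs'.1.
move=> k a hk; have [le|lt] := leqP (cost c g) k; last exact: (hb k (ltnW lt) a).
by rewrite rn // -hr; apply: hb.
Qed.

(** * Static bounds on the size of numbers *)

Section Degrees.

Variables (X : nat) (D : nat -> nat) (dm K : nat).
Hypothesis X_gt1 : 1 < X.

(* If every variable [x] is at most [X ^ D x] and every memory cell is at most
   [X ^ dm], then the value of [e] is at most [X ^ edeg e]. *)
Fixpoint edeg (e : expr) : nat :=
  match e with
  | Cst k => k
  | Var x => D x
  | Bin OAdd e1 e2 => (maxn (edeg e1) (edeg e2)).+1
  | Bin OMul e1 e2 => edeg e1 + edeg e2
  | Bin OMin e1 e2 => minn (edeg e1) (edeg e2)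
  | Bin _ e1 _ => edeg e1
  | Rd _ => dm
  end.

Fixpoint edeg_ok (e : expr) : bool :=
  (edeg e <= K) && match e with
  | Cst _ | Var _ => true
  | Bin _ e1 e2 => edeg_ok e1 && edeg_ok e2
  | Rd e1 => edeg_ok e1
  end.

Fixpoint cdeg_ok (c : cmd) : bool :=
  match c with
  | Asg x e => edeg_ok e && (edeg e <= D x)
  | Wr e1 e2 => [&& edeg_ok e1, edeg_ok e2 & edeg e2 <= dm]
  | Seq c1 c2 => cdeg_ok c1 && cdeg_ok c2
  | If e c1 => edeg_ok e && cdeg_ok c1
  | For i x c1 => (D x <= D i) && cdeg_ok c1
  end.

Definition bounded (s : state) :=
  (forall x, x < tmp -> var s x <= X ^ D x) /\ (forall a, ram s a <= X ^ dm).

Lemma eval_deg e s : ewf e -> bounded s -> eval e s <= X ^ edeg e.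
Proof.
move=> + [hv hm]; elim: e => [k _|x hx|o e1 IH1 e2 IH2|e _ _] /=.
- by apply: ltnW; apply: ltn_expl.
- exact: hv.
- move=> /andP[/IH1 h1 /IH2 h2].
  have X0 : 0 < X := ltnW X_gt1.
  case: o => /=.
  + have a1 := leq_trans h1 (leq_pexp2l X0 (leq_maxl (edeg e1) (edeg e2))).
    have a2 := leq_trans h2 (leq_pexp2l X0 (leq_maxr (edeg e1) (edeg e2))).
    rewrite expnS; apply: leq_trans (leq_mul X_gt1 (leqnn _)).
    by rewrite mul2n -addnn; exact: leq_add.
  + by apply: leq_trans (leq_subr _ _) h1.
  + by rewrite expnD leq_mul.
  + by apply: leq_trans (leq_div _ _) h1.
  + rewrite /minn; case: ifP => hd; case: ifP => he //.
      by apply: leq_trans (ltnW hd) h2.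
    by apply: leq_trans h1; rewrite leqNgt hd.
- exact: hm.
Qed.

Lemma esafe_deg e s : ewf e -> edeg_ok e -> bounded s -> esafe (X ^ K) e s.
Proof.
have X0 : 0 < X := ltnW X_gt1.
move=> we ok b; elim: e we ok => [k|x|o e1 IH1 e2 IH2|e IH] we.
all: move=> /= /andP[hd ok]; split;
  first by apply: leq_trans (eval_deg we b) _; rewrite leq_pexp2l.
all: try by [].
- by move: we ok => /= /andP[/IH1 h1 /IH2 h2] /andP[/h1 ? /h2 ?].
- exact: IH.
Qed.

(** The table of degrees is an invariant of every command, so a syntactic check suffices even for
    nested loops; a counter is bounded by its limit, hence the condition [D x <= D i] for loops. *)
Lemma safe_deg c s : wf c -> cdeg_ok c -> bounded s ->
  bounded (den c s) /\ safe (X ^ K) c s.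
Proof.
have X0 : 0 < X := ltnW X_gt1.
have set_ok s0 x v : bounded s0 -> v <= X ^ D x -> bounded (set_var s0 x v).
  by move=> [hv hm] hx; split=> //= y hy; rewrite /upd; case: eqP => [->|_] //; apply: hv.
elim: c s => [x e|e1 e2|c1 IH1 c2 IH2|e c IH|i x c IH] s /=.
- move=> /andP[hx we] /andP[d0 hd] b; split; last exact: esafe_deg.
  by apply: set_ok => //; apply: leq_trans (eval_deg we b) _; rewrite leq_pexp2l.
- move=> /andP[w1 w2] /and3P[d1 d2 hd] b; split; last by split; apply: esafe_deg.
  have [hv hm] := b; split=> //= a; rewrite /upd; case: eqP => // _.
  by apply: leq_trans (eval_deg w2 b) _; rewrite leq_pexp2l.
- move=> /andP[w1 w2] /andP[d1 d2] b.
  have [b1 s1] := IH1 _ w1 d1 b; have [b2 s2] := IH2 _ w2 d2 b1; by [].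
- move=> /andP[we w] /andP[d0 d1] b; have [b1 s1] := IH _ w d1 b.
  by split; [case: ifP|split=> //; apply: esafe_deg].
- move=> /andP[hi /andP[hx /and4P[hxi hic hxc wc]]] /andP[hd ok] b.
  have lb k : k <= var s x -> bounded (loop_state i c k s).
    elim: k => [|k IHk] hk; first by apply: set_ok.
    have [b1 _] := IH _ wc ok (IHk (ltnW hk)).
    rewrite /loop_state /= /loop_body -/(loop_state i c k s) var_den // loop_state_index //.
    apply: set_ok => //; apply: leq_trans hk _; apply: leq_trans (b.1 _ hx) _.
    by rewrite leq_pexp2l.
  split; first exact: lb (leqnn _).
  by move=> k hk; have [] := IH _ wc ok (lb k (ltnW hk)).
Qed.

End Degrees.

(** * Static bounds on the running time *)

Section StaticCost.

Variable lim : nat -> nat.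

(* Both the body of a conditional and the maximal number [lim x] of iterations
   of a loop are always charged. *)
Fixpoint scost (c : cmd) : nat :=
  match c with
  | Asg _ e => size (comp_expr e tmp) + 2
  | Wr e1 e2 => size (comp_expr e1 tmp) + size (comp_expr e2 tmp.+1) + 1
  | Seq c1 c2 => scost c1 + scost c2
  | If e c1 => (size (comp_expr e tmp)).+1 + scost c1
  | For _ x c1 => 3 + lim x * (scost c1 + 6)
  end.

Fixpoint limits (c : cmd) : seq nat :=
  match c with
  | Asg _ _ | Wr _ _ => [::]
  | Seq c1 c2 => limits c1 ++ limits c2
  | If _ c1 => limits c1
  | For _ x c1 => x :: limits c1
  end.

Lemma cost_le c s : wf c -> ~~ has (mem (assigned c)) (limits c) ->
  (forall x, x \in limits c -> var s x <= lim x) -> cost c s <= scost c.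
Proof.
elim: c s => [x e|e1 e2|c1 IH1 c2 IH2|e c IH|i x c IH] s //=.
- move=> /andP[w1 w2] /hasPn h hl; apply: leq_add.
  + apply: IH1 => // [|x hx]; last by apply: hl; rewrite mem_cat hx.
    by apply/hasPn => x hx; move: (h x); rewrite /= !mem_cat hx negb_or => /(_ isT)/andP[].
  + apply: IH2 => // [|x hx].
      by apply/hasPn => x hx; move: (h x); rewrite /= !mem_cat hx orbT negb_or => /(_ isT)/andP[].
    rewrite var_den; first by apply: hl; rewrite mem_cat hx orbT.
    by move: (h x); rewrite /= !mem_cat hx orbT negb_or => /(_ isT)/andP[].
- move=> /andP[we w] h hl; rewrite leq_add2l; case: ifP => // _; exact: IH.
- move=> /andP[hi /andP[hx /and4P[hxi hic hxc wc]]] /norP[_ /hasPn h] hl.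
  rewrite leq_add2l; apply: (@leq_trans (\sum_(k < var s x) (scost c + 6))).
    apply: leq_sum => k _; rewrite leq_add2r; apply: IH => //.
      by apply/hasPn => y hy; move: (h y hy); rewrite /= inE negb_or => /andP[].
    move=> y hy; have := h y hy; rewrite /= inE negb_or => /andP[h1 h2].
    by rewrite var_loop_state //; apply: hl; rewrite inE hy orbT.
  by rewrite sum_nat_const card_ord leq_mul2r hl ?orbT // inE eqxx.
Qed.

End StaticCost.

(** * Trees of representative windows *)

(* The nodes of the complete r^2-ary tree are numbered level by level, the root
   being 0; its first [k] levels have [tree_size r k] nodes. *)
Fixpoint tree_size (r k : nat) : nat :=
  if k is k'.+1 then tree_size r k' * (r * r) + 1 else 0.

Definition child (r b i j : nat) : nat := b * (r * r) + 1 + i * r + j.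

Lemma leq_tree_size r k k' : k <= k' -> tree_size r k <= tree_size r k'.
Proof.
elim: k k' => [|k IH] [|k'] //= h; rewrite leq_add2r leq_mul2r IH ?orbT //.
Qed.

Lemma child_lt r k b i j : b < tree_size r k -> i < r -> j < r ->
  child r b i j < tree_size r k.+1.
Proof.
rewrite /child /= => hb hi hj.
have h1 : b * (r * r) + r * r <= tree_size r k * (r * r) by rewrite -mulSnr leq_mul2r hb orbT.
have h2 : i * r + r <= r * r by rewrite -mulSnr leq_mul2r hi orbT.
lia.
Qed.

Section Compat.

Variables (r : nat) (col : nat -> nat).

(* A window [A] of the last vertices (the current one being [A 0]) conflicts
   with a future [X] at [(i, j)] if the vertices [A i] and [X j], which are at
   distance [i + j + 1], have the same color.  Vertices are represented by their
   successor, 0 stands for an unknown or nonexistent vertex. *)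
Definition conf (A X : nat -> nat) (i j : nat) : bool :=
  [&& i + j < r, A i != 0, X j != 0 & col (A i) == col (X j)].

Definition clash (A X : nat -> nat) : Prop := exists i j, conf A X i j.

(** [X'] is partial information on [X]. Only colors are compared: what a node stores at a position
    is some vertex of the right color, taken from a label. *)
Definition fits (X' X : nat -> nat) : Prop :=
  forall j, j < r -> X' j != 0 -> X j != 0 /\ col (X' j) = col (X j).

Lemma clash_fits A X' X : fits X' X -> clash A X' -> clash A X.
Proof.
move=> f [i [j /and4P[hr hA hX /eqP hc]]]; exists i, j; apply/and4P.
have [//|h1 h2] := f j _ hX; first lia.
by rewrite -h2 hc.
Qed.

Lemma clash_eq A A' X : (forall i, i < r -> A i = A' i) -> clash A X -> clash A' X.
Proof.
move=> e [i [j /and4P[hr hA hX hc]]]; exists i, j; apply/and4P.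
by rewrite -e //; lia.
Qed.

(** * Searching and building a tree *)

Section Tree.

Variables (V : seq nat -> Prop) (A : nat -> nat -> nat).

Let N := tree_size r r.+1.

(** [V] will be the set of reversed valid walks of a fixed length and end; the label of [b] consists
    of the first r + 1 vertices of one of them. *)
Definition found (b : nat) (X : nat -> nat) : Prop :=
  (exists2 h, V h & forall i, i <= r -> A b i = nth 0 h i) /\ ~ clash (A b) X.

Definition node_ok (b : nat) (X : nat -> nat) : Prop :=
  if A b 0 == 0 then forall h, V h -> clash (nth 0 h) X else found b X.

(* Below a node labelled with the window [A b], the futures that conflict with
   [A b] at [(i, j)] are dealt with by the child number [(i, j)], which may
   assume that the color at position [j] of the future is that of [A b i]. *)
Fixpoint tree (d b : nat) (X : nat -> nat) : Prop :=
  [/\ b < N, node_ok b X &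
      if d is d'.+1 then
        forall i j, i + j < r -> A b 0 != 0 -> A b i != 0 -> X j = 0 ->
          tree d' (child r b i j) (upd X j (A b i))
      else True].

Lemma tree_node d b X : tree d b X -> b < N /\ node_ok b X.
Proof. by case: d => [|d] []. Qed.

Definition answered (b : nat) (X : nat -> nat) : Prop := A b 0 = 0 \/ ~ clash (A b) X.

Definition nonzeros (X : nat -> nat) := count (fun j => X j != 0) (iota 0 r).

(** State of the search for [X] after [it] iterations: it has arrived at node [b], which assumes
    [X'] and has [d] levels below it. Each level passed has determined a new position of the future,
    and each iteration passes a level unless the search has ended. *)
Definition descent (X : nat -> nat) (it b : nat) : Prop :=
  exists d X', [/\ tree d b X', fits X' X, r <= d + nonzeros X'
                 & answered b X \/ d + it <= r].

Lemma descent0 X : tree r 0 (fun=> 0) -> descent X 0 0.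
Proof.
by move=> h; exists r, (fun=> 0); split=> //; [exact: leq_addr|right; rewrite addn0].
Qed.

Lemma descent_stay X it b : descent X it b -> answered b X -> descent X it.+1 b.
Proof. by move=> [d [X' [h1 h2 h3 _]]] h; exists d, X'; split=> //; left. Qed.

Lemma descent_lt X it b : descent X it b -> b < N.
Proof. by move=> [d [X' [/tree_node[]]]]. Qed.

Lemma nonzeros_upd X j x : j < r -> X j = 0 -> x != 0 ->
  nonzeros (upd X j x) = (nonzeros X).+1.
Proof.
move=> hj hX hx; rewrite /nonzeros.
have hin : j \in iota 0 r by rewrite mem_iota.
have hu := iota_uniq 0 r.
elim: (iota 0 r) hin hu => //= y l IH; rewrite inE => /orP[/eqP<-|hin] /andP[hn hu].
  rewrite {1}/upd eqxx hX hx /= add1n; congr S.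
  by apply: eq_in_count => z hz; rewrite /upd; case: (z =P j) hz hn => // -> ->.
rewrite IH // {1}/upd; case: (y =P j) => [e|_]; last by rewrite addnS.
by rewrite e hin in hn.
Qed.

Lemma nonzeros_le X : nonzeros X <= r.
Proof. by rewrite -[leqRHS](size_iota 0); apply: count_size. Qed.

(** The label is compatible with all that [X'] knows, so it can conflict with [X] only at a position
    that [X'] leaves open. *)
Lemma fits_conf X' X b i j : A b 0 != 0 -> node_ok b X' -> fits X' X ->
  conf (A b) X i j -> X' j = 0.
Proof.
move=> hA hn hf /and4P[hr hAi hX /eqP hc]; apply/eqP/negP => /negP hX'.
move: hn; rewrite /node_ok (negbTE hA) => -[_]; apply; exists i, j; apply/and4P.
have [//|_ ->] := hf j _ hX'; first lia.
by rewrite hc.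
Qed.

Lemma descent_child X it b i j : descent X it b -> A b 0 != 0 ->
  conf (A b) X i j -> descent X it.+1 (child r b i j).
Proof.
move=> [d [X' [ht hf hd ha]]] hA hc.
have hX' := fits_conf hA (tree_node ht).2 hf hc.
have /and4P[hr hAi hX /eqP hcol] := hc.
have hj : j < r by lia.
have h1 := nonzeros_upd hj hX' hAi.
have h2 := nonzeros_le (upd X' j (A b i)).
case: d ht hd ha => [|d] ht hd ha; first lia.
exists d, (upd X' j (A b i)); split.
- by case: ht => _ _; apply.
- move=> y hy; rewrite /upd; case: (y =P j) => [->|_]; last exact: hf.
  by rewrite hcol.
- lia.
- right; case: ha; last lia.
  by case=> [/eqP e|]; [rewrite e in hA|case; exists i, j].
Qed.

(** If the search has not ended after r iterations, no level is left and [X'] knows all r positions;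
    by [fits_conf] a further conflict would need another one. *)
Lemma descent_end X b : descent X r b -> node_ok b X.
Proof.
move=> [d [X' [ht hf hd ha]]]; have [_ hn] := tree_node ht.
move: (hn); rewrite /node_ok; case: eqP => [_ h h' /h|/eqP hA [hV hc]]; first exact: clash_fits.
split=> // hcl; case: ha => [[/eqP e|//]|hd']; first by rewrite e in hA.
case: hcl => i [j hij].
have hX' := fits_conf hA hn hf hij.
have /and4P[hr hAi hX /eqP hcol] := hij.
have hj : j < r by lia.
have h1 := nonzeros_upd hj hX' hAi.
have h2 := nonzeros_le (upd X' j (A b i)).
lia.
Qed.

(** Passes from the flat array of records to the recursive predicate; [B b] is the future stored
    with node [b]. Only children of labelled nodes must match their parents, as no search goes below
    an unlabelled node. *)
Lemma tree_build (B : nat -> nat -> nat) :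
  (forall b, b < N -> node_ok b (B b)) ->
  (forall b i j, child r b i j < N -> A b 0 != 0 -> i < r -> j < r ->
     forall y, y < r -> B (child r b i j) y = upd (B b) j (A b i) y) ->
  (forall j, j < r -> B 0 j = 0) ->
  tree r 0 (fun=> 0).
Proof.
move=> hn hc h0.
suff H d b X : d <= r -> b < tree_size r (r.+1 - d) ->
    (forall j, j < r -> X j = B b j) -> tree d b X.
  apply: H => //; first by rewrite subSnn.
  by move=> j hj; rewrite h0.
elim: d b X => [|d IH] b X hd hb hX.
all: have hbN : b < N by apply: leq_trans hb (leq_tree_size _ _); lia.
all: have hok : node_ok b X.
1,3: have := hn b hbN; rewrite /node_ok; case: ifP => _ => [h h' /h|[h1 h2]].
1,3: by apply: clash_fits => j hj hB; rewrite hX.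
1,2: by split=> // h; apply: h2; apply: clash_fits h => j hj hB; rewrite -hX.
- by split.
split=> // i j hij hA hAi hXj.
have hch : child r b i j < tree_size r (r.+1 - d).
  have -> : r.+1 - d = (r.+1 - d.+1).+1 by lia.
  by apply: child_lt => //; lia.
apply: IH => //; first exact: ltnW.
move=> y hy; rewrite hc //; try lia.
  by rewrite /upd; case: (y =P j) => // _; apply: hX.
by apply: leq_trans hch (leq_tree_size _ _); lia.
Qed.

End Tree.

Lemma tree_eq V A A' d b X :
  (forall b i, b < tree_size r r.+1 -> i <= r -> A b i = A' b i) ->
  tree V A d b X -> tree V A' d b X.
Proof.
move=> e; elim: d b X => [|d IH] b X [hb hn hc].
all: have hok : node_ok V A' b X.
1,3: move: hn; rewrite /node_ok /found -!e //; case: ifP => // _ [[h hV hA] hcl].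
1,2: split; [by exists h => // i hi; rewrite -e ?hA|].
1,2: by move=> h'; apply: hcl; apply: clash_eq h' => i hi; rewrite e // ltnW.
- by split.
split=> // i j hij hA hAi hX; rewrite -!e in hA hAi *; try lia.
by apply: IH; apply: hc.
Qed.

(** * Extending windows by an arc *)

Section Walks.

Variables (m s : nat) (eu ev : nat -> nat).

(* [valid q v h]: some walk of length [q] from [s] to [v] has the reversed
   vertex sequence [h] (shifted by one) and any two of its vertices at distance
   at most [r] differ in color. *)
Inductive valid : nat -> nat -> seq nat -> Prop :=
| valid0 : valid 0 s [:: s.+1]
| validS q k h : k < m -> valid q (eu k) h ->
    (forall i, i < r -> i < size h -> col (nth 0 h i) != col (ev k).+1) ->
    valid q.+1 (ev k) ((ev k).+1 :: h).

Lemma valid_pos q v h i : valid q v h -> i < size h -> nth 0 h i != 0.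
Proof.
move=> H; elim: H i => [[]|{}q k {}h _ _ IH _ [|i]] //= hi; exact: IH.
Qed.

(* [X] is the future of the walk before its last vertex [v], so that
   [X 0 = v + 1] and the future from [v] on is shifted by one. *)
Lemma valid_extend q k h X :
  k < m -> valid q (eu k) h -> X 0 = (ev k).+1 ->
  (forall j, j < r -> X j.+1 != 0 -> col (X j.+1) != col (X 0)) ->
  ~ clash (nth 0 h) X ->
  valid q.+1 (ev k) ((ev k).+1 :: h) /\ ~ clash (nth 0 ((ev k).+1 :: h)) (fun j => X j.+1).
Proof.
move=> hk hv hX0 hok hc; split.
  constructor=> // i hi his; apply/negP => /eqP e; apply: hc; exists i, 0.
  by apply/and4P; rewrite addn0 hX0 e (valid_pos hv).
move=> [[|i] [j /and4P[hr hA hX hcol]]].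
  by have := hok j hr hX; rewrite hX0 eq_sym hcol.
apply: hc; exists i, j.+1; apply/and4P; split=> //; lia.
Qed.

(** Shows that an unanswered query rules out all walks through the arc: a conflict of [h] at (i, j +
    1) becomes one of the extended walk at (i + 1, j), and a conflict at (i, 0) would contradict the
    extendability of [h]. *)
Lemma valid_extend_clash k h X :
  X 0 = (ev k).+1 ->
  (forall i, i < r -> i < size h -> col (nth 0 h i) != col (ev k).+1) ->
  clash (nth 0 h) X ->
  clash (nth 0 ((ev k).+1 :: h)) (fun j => X j.+1).
Proof.
move=> hX0 hd [i [[|j] /and4P[hr hA hX /eqP hcol]]].
  have hi : i < size h.
    by rewrite ltnNge; apply/negP => hs; rewrite nth_default ?eqxx in hA.
  by have := hd i _ hi; rewrite hcol hX0 eqxx => /(_ ltac:(lia)).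
by exists i.+1, j; apply/and4P; split=> //=; [lia|rewrite hcol].
Qed.

End Walks.

End Compat.

(** * The algorithm *)

Declare Scope prog_scope.
Delimit Scope prog_scope with prog.
Notation "x + y" := (Bin OAdd x y) : prog_scope.
Notation "x - y" := (Bin OSub x y) : prog_scope.
Notation "x * y" := (Bin OMul x y) : prog_scope.
Notation "x / y" := (Bin ODiv x y) : prog_scope.
Notation "'`' n" := (Cst n) (at level 8, n constr, format "'`' n") : prog_scope.
Notation "'#' n" := (Var n) (at level 8, n constr, format "'#' n") : prog_scope.
Notation "x ::= e" := (Asg x e%prog) (at level 70) : prog_scope.
Notation "c ;; d" := (Seq c d) (at level 90, right associativity) : prog_scope.

Definition Eq (x y : expr) : expr := (`1 - ((x - y) + (y - x)))%prog.

Lemma eval_Eq x y s : eval (Eq x y) s = (eval x s == eval y s).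
Proof. by rewrite /=; case: eqP => /=; lia. Qed.

Module V.
Notation acc := 0.
Notation n := 1.
Notation m := 2.
Notation s := 3.
Notation t := 4.
Notation r0 := 5.
Notation l0 := 6.
Notation r := 7.
Notation l := 8.
Notation base := 9.
Notation N := 10.
Notation r2 := 11.
Notation w := 12.
Notation c := 13.
Notation q := 14.
Notation a := 15.
Notation k := 16.
Notation u := 17.
Notation v := 18.
Notation b := 19.
Notation it := 20.
Notation i := 21.
Notation j := 22.
Notation P := 23.
Notation Q := 24.
Notation ok := 25.
Notation nb := 26.
Notation x := 27.
Notation pi := 28.
Notation pj := 29.
End V.

Open Scope prog_scope.

(* The record of node [a] of the tree of vertex [v] for walks of length [q] has
   2 r + 2 cells: the window [A 0, ..., A r] labelling the node, where
   [A 0 = v + 1] unless the node is unlabelled, followed by the future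
   [X 0, ..., X r] of the walk before [v], whose tail is what the node assumes. *)
Definition record_addr (q v a : expr) : expr :=
  #V.base + ((q * #V.n + v) * #V.N + a) * #V.w.

(** The minimum with [n] serves the size analysis: it gives [u] and [v] the degree of [n], while
    encoded end vertices are below [n] anyway. The minimum with [N] in [descend] has the same
    purpose. *)
Definition load_arc : cmd :=
  V.u ::= Bin OMin (Rd (`6 + #V.n + (#V.k + #V.k))) #V.n;;
  V.v ::= Bin OMin (Rd (`7 + #V.n + (#V.k + #V.k))) #V.n;;
  V.P ::= record_addr (#V.q + `1) #V.v #V.a.

Definition fill_future : cmd :=
  Wr (#V.P + #V.r + `1) (#V.v + `1);;
  If #V.a (
    V.x ::= (#V.a - `1) / #V.r2;;
    V.pi ::= (#V.a - `1 - #V.x * #V.r2) / #V.r;;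
    V.pj ::= #V.a - `1 - #V.x * #V.r2 - #V.pi * #V.r;;
    V.Q ::= record_addr (#V.q + `1) #V.v #V.x;;
    For V.j V.r (Wr (#V.P + #V.r + `2 + #V.j) (Rd (#V.Q + #V.r + `2 + #V.j)));;
    Wr (#V.P + #V.r + `2 + #V.pj) (Rd (#V.Q + #V.pi))).

(** The colors start at cell 6, and vertices are represented by their successors. *)
Definition color_of (x : expr) : expr := Rd (`5 + x).

(** Detects the conflicts of the new vertex [v] itself with the assumed future; those of the earlier
    vertices are found by the query. *)
Definition check_future : cmd :=
  V.ok ::= `1;;
  For V.j V.r (
    If (Rd (#V.P + #V.r + `2 + #V.j)) (
    If (Eq (color_of (Rd (#V.P + #V.r + `2 + #V.j))) (color_of (#V.v + `1)))
       (V.ok ::= `0))).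

(** The value 0 of [nb] can stand for no conflict because no child has number 0. *)
Definition find_conflict : cmd :=
  V.nb ::= `0;;
  For V.i V.r (For V.j V.r (
    If (#V.r - (#V.i + #V.j)) (
    If (Rd (#V.Q + #V.i)) (
    If (Rd (#V.P + #V.r + `1 + #V.j)) (
    If (Eq (color_of (Rd (#V.Q + #V.i))) (color_of (Rd (#V.P + #V.r + `1 + #V.j))))
       (V.nb ::= #V.b * #V.r2 + `1 + #V.i * #V.r + #V.j)))))).

Definition descend : cmd :=
  V.b ::= `0;;
  For V.it V.r (
    V.Q ::= record_addr #V.q #V.u #V.b;;
    If (Rd #V.Q) (find_conflict;; If #V.nb (V.b ::= Bin OMin #V.nb #V.N))).

Definition store : cmd :=
  V.Q ::= record_addr #V.q #V.u #V.b;;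
  If #V.ok (If (Rd #V.Q) (
    Wr #V.P (#V.v + `1);;
    For V.i V.r (Wr (#V.P + `1 + #V.i) (Rd (#V.Q + #V.i)));;
    If (Eq #V.v #V.t) (V.acc ::= `1))).

Definition process_arc : cmd :=
  load_arc;; fill_future;; check_future;; descend;; store.

Definition layers : cmd :=
  Wr (record_addr `0 #V.s `0) (#V.s + `1);;
  For V.q V.l (For V.a V.N (For V.k V.m process_arc)).

Definition count_nodes : cmd :=
  V.r2 ::= #V.r * #V.r;;
  V.w ::= #V.r + #V.r + `2;;
  V.N ::= `1;;
  For V.c V.r (V.N ::= #V.N * #V.r2 + `1).

Definition prelude : cmd :=
  V.n ::= Rd `0;; V.m ::= Rd `1;; V.s ::= Rd `2;; V.t ::= Rd `3;;
  V.r0 ::= Rd `4;; V.l0 ::= Rd `5.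

Definition short_params : cmd :=
  V.r ::= `0;;
  V.l ::= Bin OMin #V.l0 (#V.r0 - `1);;
  V.base ::= `6 + #V.n + #V.m + #V.m.

(** For r = 0 each tree has one node and each record two cells, so the first run stays within (l +
    1) n 2 cells and the second one finds zeros from [base] on. *)
Definition long_params : cmd :=
  V.base ::= `6 + #V.n + #V.m + #V.m + (#V.l0 + `1) * #V.n * `2;;
  V.r ::= #V.r0;;
  V.l ::= #V.l0.

(* A walk of length less than r is rainbow whatever its colors are, so the
   algorithm is run once with r replaced by 0 and the length bounded by r - 1. *)
Definition algorithm : cmd :=
  prelude;;
  If #V.l0 (short_params;; count_nodes;; layers;;
            long_params;; count_nodes;; layers).

Close Scope prog_scope.

Lemma loop_ind (Inv : nat -> state -> Prop) i x c s :
  i \notin assigned c ->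
  Inv 0 (set_var s i 0) ->
  (forall k s', k < var s x -> var s' i = k ->
     (forall y, y != i -> y \notin assigned c -> var s' y = var s y) ->
     Inv k s' -> Inv k.+1 (set_var (den c s') i k.+1)) ->
  Inv (var s x) (den (For i x c) s).
Proof.
move=> hi h0 hS; rewrite /=.
have H k : k <= var s x -> Inv k (loop_state i c k s).
  elim: k => [|k IH] hk //.
  have := hS k (loop_state i c k s) hk (loop_state_index _ _ hi) _ (IH (ltnW hk)).
  rewrite /loop_state /= /loop_body var_den // -/(loop_state i c k s) loop_state_index //.
  by apply=> y hy hyc; apply: var_loop_state.
exact: H (leqnn _).
Qed.

(** * Correctness of the algorithm *)

Lemma den_asg x e s : den (Asg x e) s = set_var s x (eval e s).
Proof. by []. Qed.

Lemma den_wr e1 e2 s :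
  den (Wr e1 e2) s = State (var s) (upd (ram s) (eval e1 s) (eval e2 s)).
Proof. by []. Qed.

Lemma den_seq c1 c2 s : den (Seq c1 c2) s = den c2 (den c1 s).
Proof. by []. Qed.

Lemma den_if e c s : den (If e c) s = if eval e s == 0 then s else den c s.
Proof. by []. Qed.

Lemma upd_eq f x v : upd f x v x = v.
Proof. by rewrite /upd eqxx. Qed.

Lemma upd_neq f x v y : y != x -> upd f x v y = f y.
Proof. by rewrite /upd => /negbTE->. Qed.

Lemma var_set S x v y : var (set_var S x v) y = if y == x then v else var S y.
Proof. by []. Qed.

Lemma ram_set S x v : ram (set_var S x v) = ram S.
Proof. by []. Qed.

Local Opaque den set_var.

(** * A single run for given r, l and base *)

Section Layers.

Variables (n m s t r l base : nat) (inp : nat -> nat).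

Let N := tree_size r r.+1.
Let w := r + r + 2.
Let eu k := inp (6 + n + (k + k)).
Let ev k := inp (7 + n + (k + k)).
Let col x := inp (5 + x).

(* Indexed by the numbers of the variables in the module [V]. *)
Definition par (x : nat) : nat :=
  nth 0 [:: 0; n; m; s; t; 0; 0; r; l; base; N; r * r; w] x.

Definition params := [:: V.n; V.m; V.s; V.t; V.r; V.l; V.base; V.N; V.r2; V.w].

Definition env (S : state) : Prop := forall x, x \in params -> var S x = par x.

Lemma env_den c S : ~~ has (mem (assigned c)) params -> env S -> env (den c S).
Proof.
by move=> /hasPn hc h x hx; rewrite var_den ?h //; apply: hc.
Qed.

Lemma env_set S x v : x \notin params -> env S -> env (set_var S x v).
Proof.
move=> hx h y hy; rewrite var_set; case: eqP => [e|_]; last exact: h.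
by case/negP: hx; rewrite -e.
Qed.

Definition idx q v a := (q * n + v) * N + a.
Definition addr q v a := base + idx q v a * w.

Hypothesis base_ge : 6 + n + m + m <= base.
Hypothesis eu_lt : forall k, k < m -> eu k < n.
Hypothesis ev_lt : forall k, k < m -> ev k < n.
Hypothesis s_lt : s < n.

(** [inp] is all that lies below [base], which for the second run includes the records of the first.
    The bound by [n] above [base] ensures that looking up the color of a stored vertex stays within
    the encoded colors. *)
Definition ram_ok (M : nat -> nat) : Prop :=
  (forall y, y < base -> M y = inp y) /\ (forall y, base <= y -> M y <= n).

Lemma ram_ok_upd M y v : ram_ok M -> base <= y -> v <= n -> ram_ok (upd M y v).
Proof.
move=> [h1 h2] hy hv; split=> z hz; rewrite /upd; case: eqP => [e|_] //; first lia.
- exact: h1.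
- exact: h2.
Qed.

Lemma col_ok M x : ram_ok M -> x <= n -> M (5 + x) = col x.
Proof. by move=> [h1 _] hx; rewrite h1 //; lia. Qed.

Lemma addrE S q v a : env S ->
  eval (record_addr q v a) S = addr (eval q S) (eval v S) (eval a S).
Proof. by move=> h; rewrite /record_addr /= !h. Qed.

Lemma load_arcE S k : env S -> ram_ok (ram S) -> var S V.k = k -> k < m ->
  [/\ ram (den load_arc S) = ram S, var (den load_arc S) V.u = eu k,
      var (den load_arc S) V.v = ev k
    & var (den load_arc S) V.P = addr (var S V.q).+1 (ev k) (var S V.a)].
Proof.
move=> h [hM _] hk hkm; rewrite /load_arc !den_seq !den_asg.
set S1 := set_var S _ _; have h1 : env S1 by exact: env_set.
set S2 := set_var S1 _ _; have h2 : env S2 by exact: env_set.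
have e1 : var S1 V.u = eu k.
  rewrite var_set /= hk h // hM -/(eu k); last by rewrite /= /par /=; lia.
  by apply/minn_idPl; apply: ltnW; apply: eu_lt.
have e2 : var S2 V.v = ev k.
  rewrite var_set /= !(var_set, ram_set) /= hk h // hM -/(ev k); last by rewrite /= /par /=; lia.
  by apply/minn_idPl; apply: ltnW; apply: ev_lt.
have e3 : var S2 V.u = eu k by rewrite var_set.
rewrite addrE //= !var_set /=; split=> //.
by rewrite -/(ev k) -e2 var_set /= addn1.
Qed.

Lemma fill_futureE S : env S -> let P := var S V.P in
  let M := ram S in let M' := ram (den fill_future S) in
  let a := var S V.a in let x := a.-1 %/ (r * r) in
  let pi := a.-1 %% (r * r) %/ r in let pj := a.-1 %% (r * r) %% r in
  let Q := addr (var S V.q).+1 (var S V.v) x in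
  (a != 0 -> pj < r) -> (a != 0 -> pi <= r) -> (a != 0 -> Q + w <= P) ->
  [/\ M' (P + r + 1) = (var S V.v).+1,
      forall j, j < r -> M' (P + r + 1 + j.+1) =
        if a == 0 then M (P + r + 1 + j.+1)
        else upd (fun j => M (Q + r + 1 + j.+1)) pj (M (Q + pi)) j
    & forall y, y < P + r + 1 \/ P + w <= y -> M' y = M y].
Proof.
move=> h P M; rewrite /fill_future den_seq den_wr den_if.
set S1 := State _ _; have h1 : env S1 by [].
have M1 y : ram S1 y = if y == P + r + 1 then (var S V.v).+1 else M y.
  by rewrite /S1 /= /upd (h V.r) //= !addn1.
move: S1 h1 M1 (erefl : var S1 = var S) => S1 h1 M1 v1.
rewrite /= v1; set a := var S V.a.
have [a0|a0] := eqVneq a 0.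
  by move=> *; split=> [|j hj|y hy]; rewrite M1 ?eqxx //; case: eqP => //; rewrite /w; lia.
set x := a.-1 %/ (r * r); set pi := a.-1 %% (r * r) %/ r; set pj := a.-1 %% (r * r) %% r.
set Q := addr _ _ x => /(_ isT) hpj /(_ isT) hpi /(_ isT) hQ.
rewrite !den_seq !den_asg den_wr.
set S2 := set_var S1 _ _; have h2 : env S2 by exact: env_set.
set S3 := set_var S2 _ _; have h3 : env S3 by exact: env_set.
set S4 := set_var S3 _ _; have h4 : env S4 by exact: env_set.
set S5 := set_var S4 _ _; have h5 : env S5 by exact: env_set.
have ex : var S2 V.x = x by rewrite var_set /= v1 (h V.r2) //= subn1.
have emod : a - 1 - x * (r * r) = a.-1 %% (r * r).
  by rewrite subn1 {1}(divn_eq a.-1 (r * r)) addKn.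
have epi : var S3 V.pi = pi.
  by rewrite var_set /= (h2 V.r) ?(h2 V.r2) //= ex var_set /= v1 emod.
have ex3 : var S3 V.x = x by rewrite var_set /= ex.
have ea3 : var S3 V.a = a by rewrite !var_set /= v1.
have epj : var S4 V.pj = pj.
  rewrite var_set /= (h3 V.r) ?(h3 V.r2) //= epi ex3 ea3 emod.
  by rewrite {1}(divn_eq (a.-1 %% (r * r)) r) addKn.
have ex4 : var S4 V.x = x by rewrite var_set /= ex3.
have eQ : var S5 V.Q = Q.
  by rewrite var_set eqxx addrE //= ex4 !var_set /= v1 addn1.
have f y : y \notin [:: V.x; V.pi; V.pj; V.Q] -> var S5 y = var S y.
  rewrite !inE !negb_or => /and4P[/negbTE y1 /negbTE y2 /negbTE y3 /negbTE y4].
  by rewrite !var_set y1 y2 y3 y4 v1.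
have M5 : ram S5 = ram S1 by [].
have epi5 : var S5 V.pi = pi by rewrite !var_set /= -epi var_set.
have epj5 : var S5 V.pj = pj by rewrite !var_set /= -epj var_set.
move: S5 h5 eQ f M5 epi5 epj5 => S5 h5 eQ f M5 epi5 epj5.
clear ex ex3 ex4 ea3 emod epi epj; clearbody Q pj pi x.
set c := Wr _ _; set S6 := den (For V.j V.r c) S5.
have M6 y : ram S6 y = if P + r + 2 <= y < P + r + 2 + r
    then M (Q + r + 2 + (y - (P + r + 2))) else ram S1 y.
  have := @loop_ind (fun k s => forall y, ram s y = if P + r + 2 <= y < P + r + 2 + k
    then M (Q + r + 2 + (y - (P + r + 2))) else ram S1 y) V.j V.r c S5.
  rewrite (h5 V.r isT : _ = r); apply=> //.
    by move=> z; rewrite ram_set M5 addn0; case: ifP => //; lia.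
  move=> k s' hk ek hv IH z.
  have vP : var s' V.P = P by rewrite hv // f.
  have vQ : var s' V.Q = Q by rewrite hv.
  have vr : var s' V.r = r by rewrite hv // h5.
  rewrite ram_set den_wr /= /upd vP vr ek vQ.
  case: eqP => [->|hne].
    rewrite ltn_add2l ltnSn leq_addr /= IH.
    case: ifP; first by rewrite /w in hQ; lia.
    by move=> _; rewrite M1 addKn; case: eqP => //; rewrite /w in hQ; lia.
  rewrite IH; case: ifP => hz; case: ifP => hz' //; lia.
have h6 : env S6 by exact: env_den.
have f6 y : y != V.j -> var S6 y = var S5 y.
  by move=> hy; rewrite var_den //= inE hy.
have eA : ram S6 (Q + pi) = M (Q + pi).
  rewrite M6; case: ifP; first by rewrite /w in hQ; lia.
  by move=> _; rewrite M1; case: eqP => //; rewrite /w in hQ; lia.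
split=> [|j hj|y hy]; rewrite /= /upd !f6 // epi5 epj5 eQ f // -/P (h5 V.r) // /par /= eA.
- case: eqP; first lia.
  by move=> _; rewrite M6 M1 eqxx; case: ifP => //; lia.
- case: eqP => e.
    by case: eqP => //; lia.
  case: eqP => [e'|_]; first lia.
  rewrite M6; case: ifP; last lia.
  by move=> _; congr M; lia.
- case: eqP; first by rewrite /w in hy; lia.
  move=> _; rewrite M6; case: ifP; first by rewrite /w in hy; lia.
  by rewrite M1; case: eqP => //; rewrite /w in hy; lia.
Qed.

Lemma check_futureE S : env S -> ram_ok (ram S) -> base <= var S V.P -> var S V.v < n ->
  let X j := ram S (var S V.P + r + 1 + j.+1) in
  ram (den check_future S) = ram S /\
  (var (den check_future S) V.ok != 0 <->
   forall j, j < r -> X j != 0 -> col (X j) != col (var S V.v).+1).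
Proof.
move=> h hM hP hv X; rewrite /check_future den_seq den_asg.
set S1 := set_var S _ _; have h1 : env S1 by exact: env_set.
set c := If _ _.
have := @loop_ind (fun k s => ram s = ram S /\
   (var s V.ok != 0 <-> forall j, j < k -> X j != 0 -> col (X j) != col (var S V.v).+1))
   V.j V.r c S1.
rewrite (h1 V.r isT : _ = r); apply=> //.
move=> k s' hk ek hy [IHr IHv]; rewrite ram_set var_set /=.
have -> : den c s' = if (X k != 0) && (col (X k) == col (var S V.v).+1)
    then set_var s' V.ok 0 else s'.
  have vP : var s' V.P = var S V.P by rewrite hy // var_set.
  have vv : var s' V.v = var S V.v by rewrite hy // var_set.
  have vr : var s' V.r = r by rewrite hy // h1.
  rewrite /c !den_if den_asg eval_Eq /= vP vv vr ek IHr.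
  have -> : var S V.P + r + 2 + k = var S V.P + r + 1 + k.+1 by lia.
  rewrite -/(X k); case: eqP => //= _.
  have hX : X k <= n by apply: hM.2; lia.
  by rewrite (col_ok hM hX) addn1 (col_ok hM) //; case: (col _ == _).
case: ifP => hc; rewrite ?ram_set ?var_set /=; split=> //; split=> //.
- move=> H; have /andP[hX hcol] := hc; have := H k (ltnSn k) hX; by rewrite hcol.
- move=> /IHv H j; rewrite ltnS leq_eqVlt => /orP[/eqP->|]; last exact: H.
  by move=> hX; move: hc; rewrite hX /= => ->.
- by move=> H; apply/IHv => j hj; apply: H; apply: ltnW.
Qed.

Lemma find_conflictE S : env S -> ram_ok (ram S) -> base <= var S V.P -> base <= var S V.Q ->
  let A i := ram S (var S V.Q + i) in
  let X j := ram S (var S V.P + r + 1 + j) in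
  ram (den find_conflict S) = ram S /\
  (var (den find_conflict S) V.nb = 0 /\ ~ clash r col A X \/
   exists i j, conf r col A X i j /\ var (den find_conflict S) V.nb = child r (var S V.b) i j).
Proof.
move=> h hM hP hQ A X; rewrite /find_conflict den_seq den_asg.
set S1 := set_var S _ _; have h1 : env S1 by exact: env_set.
set c := For V.j _ _; set c' := If _ _ in c *.
have body s' i j : (forall y, y \notin [:: V.i; V.j; V.nb] -> var s' y = var S y) ->
    ram s' = ram S -> var s' V.i = i -> var s' V.j = j ->
  den c' s' = if conf r col A X i j then set_var s' V.nb (child r (var S V.b) i j) else s'.
  move=> hv hr ei ej.
  have vP := hv V.P isT; have vQ := hv V.Q isT; have vb := hv V.b isT.
  have vr : var s' V.r = r by rewrite hv // h.
  have v2 : var s' V.r2 = r * r by rewrite hv // h.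
  rewrite /c' !den_if den_asg eval_Eq /= vP vQ vb vr v2 hr ei ej /= -/(A i) -/(X j).
  rewrite /conf subn_eq0 leqNgt.
  case: (_ < r) => //=; case: eqP => //= _; case: eqP => //= _.
  have hA : A i <= n by apply: hM.2; lia.
  have hX : X j <= n by apply: hM.2; lia.
  by rewrite (col_ok hM hA) (col_ok hM hX); case: (col _ == _).
pose Good k i s := ram s = ram S /\
   (var s V.nb = 0 /\ (forall i' j, i' < i \/ i' = i /\ j < k -> ~~ conf r col A X i' j) \/
   exists i j, conf r col A X i j /\ var s V.nb = child r (var S V.b) i j).
have H : Good 0 r (den (For V.i V.r c) S1).
  have := @loop_ind (Good 0) V.i V.r c S1.
  rewrite (h1 V.r isT : _ = r); apply=> //.
    by split=> //; left; rewrite !var_set; split=> // i' j [|[]].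
  move=> i s' hi ei hy IH.
  have hi' : env s'.
    move=> y hy'; have : all (fun y => (y != V.i) && (y \notin assigned c)) params by [].
    by move/allP/(_ y hy')/andP => [p1 p2]; rewrite hy ?h1.
  have H2 : Good r i (den c s').
    have := @loop_ind (fun k s => Good k i s) V.j V.r c' s'.
    rewrite (hi' V.r isT : _ = r); apply=> //.
    move=> j s2 hj ej hy2 [IHr IHv].
    have hy' y : y \notin [:: V.i; V.j; V.nb] -> var s2 y = var S y.
      rewrite !inE !negb_or => /and3P[y1 y2 y3].
      rewrite hy2 //= ?inE // hy //= ?inE ?negb_or ?y2 ?y3 //.
      by rewrite var_set (negbTE y3).
    rewrite (body s2 i j) //; last by rewrite hy2.
    split; first by case: ifP.
    case: ifP => hc; rewrite !var_set /=; first by right; exists i, j.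
    case: IHv => [[e0 H]|]; last by right.
    left; split=> // i' j' [hlt|[-> hlt]]; first by apply: H; left.
    move: hlt; rewrite ltnS leq_eqVlt => /orP[/eqP->|hlt]; first by rewrite hc.
    by apply: H; right.
  case: H2 => [Hr H2]; split; first by rewrite ram_set.
  rewrite var_set /=; case: H2 => [[e0 H2]|]; last by right.
  left; split=> // i' j [|[]//]; rewrite ltnS leq_eqVlt => /orP[/eqP->|hlt]; last by apply: H2; left.
  have [hj|hj] := ltnP j r; first by apply: H2; right.
  by rewrite /conf ltnNge (leq_trans hj (leq_addl _ _)).
case: H => [Hr H]; split=> //; case: H => [[e0 H]|]; last by right.
left; split=> // -[i [j hc]].
have hi : i < r by case/andP: hc => hc _; lia.
by have := H i j (or_introl hi); rewrite hc.
Qed.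
(** Records are arranged lexicographically by (q, v, a), whence different records occupy disjoint
    cells. *)
Lemma idx_lt_q q q' v v' a a' : q < q' -> v < n -> a < N -> idx q v a < idx q' v' a'.
Proof.
move=> hq hv ha; rewrite /idx.
have h1 : (q * n + v).+1 <= q' * n.
  by apply: (@leq_trans (q.+1 * n)); [rewrite mulSn; lia|rewrite leq_mul2r hq orbT].
have h2 : (q * n + v).+1 * N <= q' * n * N by rewrite leq_mul2r h1 orbT.
rewrite mulSn in h2; rewrite (mulnDl (q' * n) v' N); lia.
Qed.

Lemma idx_lt_v q v v' a a' : v < v' -> a < N -> idx q v a < idx q v' a'.
Proof.
move=> hv ha; rewrite /idx.
have h2 : (q * n + v).+1 * N <= (q * n + v') * N by rewrite leq_mul2r; apply/orP; right; lia.
rewrite mulSn in h2; lia.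
Qed.

Lemma idx_lt_a q v a a' : a < a' -> idx q v a < idx q v a'.
Proof. by rewrite /idx ltn_add2l. Qed.

Lemma addr_lt q q' v v' a a' : idx q v a < idx q' v' a' -> addr q v a + w <= addr q' v' a'.
Proof.
move=> h; rewrite /addr -addnA leq_add2l -mulSnr leq_mul2r h orbT //.
Qed.

Lemma base_addr q v a : base <= addr q v a.
Proof. exact: leq_addr. Qed.

Let win (M : nat -> nat) q v a i := M (addr q v a + i).
Let fut (M : nat -> nat) q v a j := M (addr q v a + r + 1 + j).
Let walk := valid r col m s eu ev.

Lemma descendE S V : env S -> ram_ok (ram S) -> base <= var S V.P ->
  let A := win (ram S) (var S V.q) (var S V.u) in
  let X j := ram S (var S V.P + r + 1 + j) in
  tree r col V A r 0 (fun=> 0) ->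
  [/\ ram (den descend S) = ram S, var (den descend S) V.b < N
    & node_ok r col V A (var (den descend S) V.b) X].
Proof.
move=> h hM hP A X hT; rewrite /descend den_seq den_asg.
set S1 := set_var S _ _; have h1 : env S1 by exact: env_set.
set c := Seq _ _.
suff H : ram (den (For V.it V.r c) S1) = ram S /\
    descent r col V A X r (var (den (For V.it V.r c) S1) V.b).
  case: H => H1 H2; split=> //; [exact: descent_lt H2|exact: descent_end H2].
have := @loop_ind (fun k s => ram s = ram S /\ descent r col V A X k (var s V.b)) V.it V.r c S1.
rewrite (h1 V.r isT : _ = r); apply=> //.
  by split=> //; rewrite !var_set /=; apply: descent0.
move=> k s' hk ek hy [IHr IHd]; rewrite ram_set var_set /= /c den_seq den_asg.
have h' : env s'.
  move=> y hy'; have : all (fun y => (y != V.it) && (y \notin assigned c)) params by [].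
  by move/allP/(_ y hy')/andP => [p1 p2]; rewrite hy ?h1.
have vP : var s' V.P = var S V.P by rewrite hy // var_set.
have vq : var s' V.q = var S V.q by rewrite hy // var_set.
have vu : var s' V.u = var S V.u by rewrite hy // var_set.
set b := var s' V.b in IHd.
set S2 := set_var s' _ _; have h2 : env S2 by exact: env_set.
have vQ : var S2 V.Q = addr (var S V.q) (var S V.u) b.
  by rewrite var_set eqxx addrE //= vq vu.
have vb : var S2 V.b = b by rewrite var_set.
have r2 : ram S2 = ram S by rewrite ram_set.
rewrite den_if /= vQ r2.
have -> : ram S (addr (var S V.q) (var S V.u) b) = A b 0 by rewrite /A /win addn0.
case: eqP => [e0|/eqP A0].
  by rewrite r2 vb; split=> //; apply: descent_stay => //; left.
rewrite den_seq.
have := @find_conflictE S2 h2; rewrite r2 vQ vb var_set /= vP => /(_ hM hP (base_addr _ _ _)).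
set S3 := den find_conflict S2; move=> [r3 H3].
have h3 : env S3 by exact: env_den.
have vb3 : var S3 V.b = b by rewrite var_den.
rewrite den_if /=; case: H3 => [[-> hc]|[i [j [hc e]]]].
  by rewrite /= r3 vb3; split=> //; apply: descent_stay => //; right.
have hd := descent_child IHd A0 hc.
have nz : (child r b i j == 0) = false by rewrite /child; apply/eqP; lia.
by rewrite e nz den_asg ram_set var_set /= e h3 //= (minn_idPl (ltnW (descent_lt hd))).
Qed.

Lemma storeE S : env S -> let M := ram S in let M' := ram (den store S) in
  let P := var S V.P in
  let Q := addr (var S V.q) (var S V.u) (var S V.b) in
  Q + w <= P ->
  if (var S V.ok == 0) || (M Q == 0) then
    M' = M /\ var (den store S) V.acc = var S V.acc
  else
    [/\ M' P = (var S V.v).+1, forall i, i < r -> M' (P + i.+1) = M (Q + i),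
        forall y, y < P \/ P + r < y -> M' y = M y
      & var (den store S) V.acc = if var S V.v == t then 1 else var S V.acc].
Proof.
move=> h M M' P Q hQ; rewrite {}/M' /store den_seq den_asg.
set S1 := set_var S _ _; have h1 : env S1 by exact: env_set.
have vQ : var S1 V.Q = Q by rewrite var_set eqxx addrE.
have f1 y : y != V.Q -> var S1 y = var S y by move=> hy; rewrite var_set (negbTE hy).
have r1 : ram S1 = M by rewrite ram_set.
rewrite !den_if /= f1 // r1 vQ; case: eqP => /= _; first by rewrite r1 f1.
case: eqP => /= _; first by rewrite r1 f1.
rewrite !den_seq den_wr /= (f1 V.P) // (f1 V.v) // -/P r1 addn1.
set S2 := State _ _; have h2 : env S2 by [].
have v2 y : var S2 y = var S1 y by [].
have r2 : ram S2 = upd M P (var S V.v).+1 by [].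
move: S2 h2 v2 r2 => S2 h2 v2 r2.
set c := Wr _ _; set S3 := den (For V.i V.r c) S2.
have M3 y : ram S3 y = if P < y <= P + r then M (Q + (y - P.+1)) else ram S2 y.
  have := @loop_ind (fun k s => forall y, ram s y = if P < y <= P + k
    then M (Q + (y - P.+1)) else ram S2 y) V.i V.r c S2.
  rewrite (h2 V.r isT : _ = r); apply=> //.
    by move=> z; rewrite ram_set addn0; case: ifP => //; lia.
  move=> k s' hk ek hv IH z.
  have vP : var s' V.P = P by rewrite hv // v2 f1.
  have vQ' : var s' V.Q = Q by rewrite hv // v2.
  rewrite ram_set den_wr /= /upd vP ek vQ'.
  case: eqP => [->|hne].
    rewrite IH; case: ifP; first by rewrite /w in hQ; lia.
    move=> _; rewrite r2 /upd; case: eqP; first by rewrite /w in hQ; lia.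
    by move=> _; case: ifP; [move=> _; congr M|]; lia.
  rewrite IH; case: ifP => hz; case: ifP => hz' //; lia.
have f3 y : y != V.i -> var S3 y = var S1 y.
  by move=> hy; rewrite var_den /= ?v2 // inE hy.
have r4 : ram (den (If (Eq (#V.v)%prog (#V.t)%prog) (V.acc ::= `1)%prog) S3) = ram S3.
  by rewrite den_if; case: ifP.
split; rewrite ?r4.
- rewrite M3 r2 upd_eq; case: ifP => //; lia.
- move=> i hi; rewrite M3; case: ifP; last lia.
  by move=> _; congr M; lia.
- move=> y hy; rewrite M3 r2 /upd; case: ifP; first lia.
  by move=> _; case: eqP => //; lia.
- rewrite den_if eval_Eq eqb0 /= !f3 // f1 // h1 //=; case: (_ == _) => /=.
    by rewrite den_asg var_set.
  by rewrite f3 // f1.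
Qed.

Lemma base_win q v a i : base <= addr q v a + i.
Proof. exact: leq_trans (base_addr q v a) (leq_addr i _). Qed.

Lemma base_fut q v a j : base <= addr q v a + r + 1 + j.
Proof. by rewrite -(addnA _ r) -addnA; apply: base_win. Qed.

Lemma node_gt0 a : a < N -> a != 0 -> 0 < r.
Proof. by rewrite /N; case: r => //= ha /negP; case; lia. Qed.

Lemma fill_future_ram_ok S : env S -> ram_ok (ram S) ->
  var S V.v < n -> var S V.a < N ->
  var S V.P = addr (var S V.q).+1 (var S V.v) (var S V.a) ->
  let M' := ram (den fill_future S) in
  let a := var S V.a in let q := (var S V.q).+1 in let v := var S V.v in
  [/\ ram_ok M', fut M' q v a 0 = v.+1,
      forall j, j < r -> fut M' q v a j.+1 =
        if a == 0 then fut (ram S) q v a j.+1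
        else upd (fun j => fut (ram S) q v (a.-1 %/ (r * r)) j.+1) (a.-1 %% (r * r) %% r)
               (win (ram S) q v (a.-1 %/ (r * r)) (a.-1 %% (r * r) %/ r)) j
    & forall y, y < addr q v a + r + 1 \/ addr q v a + w <= y -> M' y = ram S y].
Proof.
move=> h hM hv ha hP M' a q v.
have := fill_futureE h; rewrite hP -/q -/v -/a -/M'.
have r0 a0 := node_gt0 ha a0.
move=> /(_ (fun a0 => ltn_pmod _ (r0 a0))).
have hpi : a != 0 -> a.-1 %% (r * r) %/ r <= r.
  by move=> a0; rewrite ltnW // ltn_divLR ?r0 // ltn_pmod // muln_gt0 r0.
move=> /(_ hpi); have hQ : a != 0 -> addr q v (a.-1 %/ (r * r)) + w <= addr q v a.
  move=> a0; apply/addr_lt/idx_lt_a; apply: leq_ltn_trans (leq_div _ _) _.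
  by rewrite prednK // lt0n.
move=> /(_ hQ)[h1 h2 h3]; split=> //; last 1 first.
- by rewrite /fut addn0.
have hb := base_addr q v a.
split=> y hy; first by rewrite h3 ?hM.1 //; left; lia.
have [hy1|hy1] := ltnP y (addr q v a + r + 1); first by rewrite h3 ?hM.2 //; left.
have [hy2|hy2] := leqP (addr q v a + w) y; first by rewrite h3 ?hM.2 //; right.
have [e|hne] := eqVneq y (addr q v a + r + 1); first by rewrite e h1.
have [j e hj] : exists2 j, y = addr q v a + r + 1 + j.+1 & j < r.
  have hy3 : addr q v a + r + 1 < y by rewrite ltn_neqAle eq_sym hne.
  exists (y - (addr q v a + r + 1)).-1; first by rewrite prednK ?subn_gt0 // subnKC // ltnW.
  by move: (addr q v a) hy2 hy3 => z; rewrite /w; clear; lia.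
rewrite e h2 //; case: ifP => _; first exact/hM.2/base_fut.
by rewrite /upd; case: ifP => _; apply: hM.2; [exact: base_win|exact: base_fut].
Qed.

Definition extendable (v : nat) (h : seq nat) : Prop :=
  forall i, i < r -> i < size h -> col (nth 0 h i) != col v.+1.

(** The two outcomes are a certificate that no extendable walk through arc [k] suits the node, with
    the label left alone, and a new label coming from such a walk. *)
Lemma process_arcE S q a k (v := ev k) (M := ram S) (S' := den process_arc S) (M' := ram S') :
  env S -> ram_ok M -> var S V.q = q -> var S V.a = a -> var S V.k = k ->
  a < N -> k < m ->
  tree r col (walk q (eu k)) (win M q (eu k)) r 0 (fun=> 0) ->
  [/\ ram_ok M',
      forall y, y < addr q.+1 v a \/ addr q.+1 v a + w <= y -> M' y = M y,
      fut M' q.+1 v a 0 = v.+1,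
      forall j, j < r -> fut M' q.+1 v a j.+1 =
        if a == 0 then fut M q.+1 v a j.+1
        else upd (fun j => fut M q.+1 v (a.-1 %/ (r * r)) j.+1) (a.-1 %% (r * r) %% r)
               (win M q.+1 v (a.-1 %/ (r * r)) (a.-1 %% (r * r) %/ r)) j
    & (forall i, i <= r -> win M' q.+1 v a i = win M q.+1 v a i) /\
      var S' V.acc = var S V.acc /\
      (forall h, walk q (eu k) h -> extendable v h ->
         clash r col (nth 0 (v.+1 :: h)) (fun j => fut M' q.+1 v a j.+1)) \/
      [/\ win M' q.+1 v a 0 != 0,
          found r col (walk q.+1 v) (win M' q.+1 v) a (fun j => fut M' q.+1 v a j.+1)
        & var S' V.acc = if v == t then 1 else var S V.acc]].
Proof.
move=> h hM hq ha hk haN hkm hT.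
rewrite {}/M' {}/S'.
rewrite /process_arc (den_seq load_arc) (den_seq fill_future) (den_seq check_future) (den_seq descend).
have [e1 eu1 ev1 eP1] := load_arcE h hM hk hkm.
have h1 : env (den load_arc S) by apply: env_den.
have ea1 : var (den load_arc S) V.a = a by rewrite var_den.
have eq1 : var (den load_arc S) V.q = q by rewrite var_den.
have ec1 : var (den load_arc S) V.acc = var S V.acc by rewrite var_den.
rewrite hq ha in eP1.
move: (den load_arc S) e1 eu1 ev1 eP1 h1 ea1 eq1 ec1 => S1 e1 eu1 ev1 eP1 h1 ea1 eq1 ec1.
have vn : v < n by apply: ev_lt.
have := @fill_future_ram_ok S1 h1; rewrite e1 ev1 ea1 eq1 -/v => /(_ hM vn haN eP1).
have := h1; move/(@env_den fill_future)=> /(_ isT) h2.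
have ff y : y \notin assigned fill_future -> var (den fill_future S1) y = var S1 y by exact: var_den.
move: (den fill_future S1) h2 ff => S2 h2 ff [hM2 f0 fj fo].
have eP2 : var S2 V.P = addr q.+1 v a by rewrite ff.
have ev2 : var S2 V.v = v by rewrite ff.
have eq2 : var S2 V.q = q by rewrite ff.
have eu2 : var S2 V.u = eu k by rewrite ff.
have ec2 : var S2 V.acc = var S V.acc by rewrite ff.
have := @check_futureE S2 h2 hM2; rewrite eP2 ev2 => /(_ (base_addr _ _ _) vn).
have := h2; move/(@env_den check_future)=> /(_ isT) h3.
have fg y : y \notin assigned check_future -> var (den check_future S2) y = var S2 y by exact: var_den.
move: (den check_future S2) h3 fg => S3 h3 fg [e3 ok3].
rewrite -e3 in hM2 f0 fj fo ok3 *.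
have eP3 : var S3 V.P = addr q.+1 v a by rewrite fg.
have ev3 : var S3 V.v = v by rewrite fg.
have eq3 : var S3 V.q = q by rewrite fg.
have eu3 : var S3 V.u = eu k by rewrite fg.
have ec3 : var S3 V.acc = var S V.acc by rewrite fg.
have un : eu k < n by apply: eu_lt.
have hlt b : b < N -> addr q (eu k) b + w <= addr q.+1 v a by move=> hb; apply/addr_lt/idx_lt_q.
have hT3 : tree r col (walk q (eu k)) (win (ram S3) q (eu k)) r 0 (fun=> 0).
  apply: tree_eq hT => b i hb hi; rewrite /win fo //; left.
  by have := hlt b hb; rewrite /w; lia.
have := @descendE S3 (walk q (eu k)) h3 hM2; rewrite eP3 eq3 eu3 => /(_ (base_addr _ _ _) hT3).
have := h3; move/(@env_den descend)=> /(_ isT) h4.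
have fd y : y \notin assigned descend -> var (den descend S3) y = var S3 y by exact: var_den.
move: (den descend S3) h4 fd => S4 h4 fd [e4 hb hn].
set b := var S4 V.b in hb hn.
rewrite -e4 in hM2 f0 fj fo ok3 hn *.
have eP4 : var S4 V.P = addr q.+1 v a by rewrite fd.
have ev4 : var S4 V.v = v by rewrite fd.
have eq4 : var S4 V.q = q by rewrite fd.
have eu4 : var S4 V.u = eu k by rewrite fd.
have ec4 : var S4 V.acc = var S V.acc by rewrite fd.
have eo4 : var S4 V.ok = var S3 V.ok by rewrite fd.
have := @storeE S4 h4; rewrite eP4 eq4 eu4 -/b => /(_ (hlt b hb)).
set S5 := den store S4; set M4 := ram S4.
set Q := addr q (eu k) b; set P := addr q.+1 v a.
have hw0 : win M4 q (eu k) b 0 = M4 Q by rewrite /win addn0.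
have X0 : M4 (P + r + 1 + 0) = v.+1 by exact: f0.
have out y : y < P \/ P + w <= y -> M4 y = M y.
  by move=> hy; apply: fo; case: hy => hy; [left|right]; rewrite -/P; lia.
case: ifP => hok.
  move=> [e5 ec5]. rewrite e5; split=> //; left; split; last split.
  - by move=> i hi; apply: fo; left; rewrite /win -/P; lia.
  - by rewrite ec5.
  move=> h' hh' he.
  have hcl : (var S3 V.ok == 0) || (M4 Q == 0) by rewrite -eo4.
  have [c0|c0] := eqVneq (M4 Q) 0.
    move: hn; rewrite /node_ok hw0 c0 eqxx => /(_ _ hh') hc.
    by apply: (@valid_extend_clash r col ev k h' (fun j => M4 (P + r + 1 + j))).
  move: hcl; rewrite (negbTE c0) orbF => /eqP o3.
  (* A window was found but [check_future] failed: some known vertex of the future has the color of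
     [v], a conflict at (0, j) for every walk ending in [v]. *)
  have [/allP H|/allPn[j]] := boolP (all (fun j => (M4 (P + r + 1 + j.+1) != 0) ==>
      (col (M4 (P + r + 1 + j.+1)) != col v.+1)) (iota 0 r)).
    have : var S3 V.ok != 0 by apply/ok3 => j hj; have := H j; rewrite mem_iota => /(_ hj)/implyP.
    by rewrite o3.
  rewrite mem_iota negb_imply negbK => hj /andP[hX hcol].
  by exists 0, j; apply/and4P; split=> //=; rewrite eq_sym.
move/negbT: hok; rewrite negb_or => /andP[k4 hA].
move=> [m1 m2 m3 ec5].
have hout y : y < P \/ P + w <= y -> ram S5 y = M y.
  move=> hy; rewrite m3 ?out //; case: hy; rewrite /w; lia.
have hfut j : fut (ram S5) q.+1 v a j = fut M4 q.+1 v a j.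
  by rewrite /fut m3 // -/P; right; lia.
have Mwin i : i <= r -> ram S5 (P + i) = if i is i'.+1 then M4 (Q + i') else v.+1.
  case: i => [_|i hi]; first by rewrite addn0 m1 ev4.
  exact: m2.
split.
- split=> y hy; first by rewrite hout ?hM.1 //; left; apply: leq_trans hy (base_addr _ _ _).
  have [hy1|hy1] := ltnP y P; first by rewrite m3 ?hM2.2 //; left.
  have [hy2|hy2] := ltnP (P + r) y; first by rewrite m3 ?hM2.2 //; right.
  rewrite -(subnKC hy1) Mwin; last lia.
  case: (y - P) => // i; apply: hM2.2; have := base_addr q (eu k) b; rewrite /Q; lia.
- exact: hout.
- by rewrite hfut.
- by move=> j hj; rewrite hfut fj.
right; split.
- by rewrite /win -/P Mwin.
- move: hn; rewrite /node_ok hw0 (negbTE hA) => -[[h' hh' heq] hc].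
  have hok3 : var S3 V.ok != 0 by rewrite -eo4.
  have okX := ok3.1 hok3.
  pose X j := M4 (P + r + 1 + j).
  have okX' : forall j, j < r -> X j.+1 != 0 -> col (X j.+1) != col (X 0).
    by move=> j hj hX; rewrite /X X0; apply: okX.
  have hc' : ~ clash r col (nth 0 h') X.
    by move=> H; apply: hc; apply: clash_eq H => i hi; rewrite -heq // ltnW.
  have [hv hncl] := valid_extend hkm hh' X0 okX' hc'.
  have hw i : i <= r -> win (ram S5) q.+1 v a i = nth 0 (v.+1 :: h') i.
    move=> hi; rewrite /win -/P Mwin //; case: i hi => //= i hi.
    by rewrite -heq // ltnW.
  split; first by exists (v.+1 :: h').
  move=> H; apply: hncl.
  have H' : clash r col (nth 0 (v.+1 :: h')) (fun j => fut (ram S5) q.+1 v a j.+1).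
    by apply: clash_eq H => i hi; rewrite hw // ltnW.
  by case: H' => i [j hij]; exists i, j; move: hij; rewrite /conf hfut.
- by rewrite ec5 ev4 ec4.
Qed.

(** * Invariants of the loops over arcs, nodes and layers *)

Lemma found_eq V A A' a X X' :
  (forall i, i <= r -> A a i = A' a i) -> (forall j, j < r -> X j = X' j) ->
  found r col V A a X -> found r col V A' a X'.
Proof.
move=> eA eX [[h hV hA] hc]; split; first by exists h => // i hi; rewrite -eA ?hA.
move=> H; apply: hc; apply: (clash_eq (A := A' a)); first by move=> i hi; rewrite eA // ltnW.
by apply: clash_fits H => j hj hX; rewrite eX.
Qed.

Lemma clash_eqr h X X' : (forall j, j < r -> X j = X' j) -> clash r col h X -> clash r col h X'.
Proof. by move=> eX; apply: clash_fits => j hj hX; rewrite -eX. Qed.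

(** Futures are written only when an arc enters the vertex; until then its record still consists of
    zeros. *)
Definition touched v k := exists2 i, i < k & ev i = v.

Lemma touchedP v k : touched v k \/ ~ touched v k.
Proof.
elim: k => [|k [[i hi e]|hk]]; first by right=> -[].
  by left; exists i => //; apply: ltnW.
have [e|ne] := eqVneq (ev k) v; first by left; exists k.
right=> -[i]; rewrite ltnS leq_eqVlt => /orP[/eqP->|hi] e; first by rewrite e eqxx in ne.
by apply: hk; exists i.
Qed.

Definition expected (M : nat -> nat) q v a j :=
  if a == 0 then 0
  else upd (fun j => fut M q v (a.-1 %/ (r * r)) j.+1) (a.-1 %% (r * r) %% r)
         (win M q v (a.-1 %/ (r * r)) (a.-1 %% (r * r) %/ r)) j.

Definition same_record (M M' : nat -> nat) q v a :=
  forall y, addr q v a <= y < addr q v a + w -> M' y = M y.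

Lemma win_same M M' q v a i : same_record M M' q v a -> i <= r -> win M' q v a i = win M q v a i.
Proof. by move=> h hi; apply: h; rewrite /w; lia. Qed.

Lemma fut_same M M' q v a j : same_record M M' q v a -> j <= r -> fut M' q v a j = fut M q v a j.
Proof. by move=> h hi; apply: h; rewrite /w; lia. Qed.

Definition fresh (M : nat -> nat) q v a := same_record (fun=> 0) M q v a.

Lemma expected_same M M' q v a j : a < N -> j < r ->
  (forall a', a' < a -> same_record M M' q v a') -> expected M' q v a j = expected M q v a j.
Proof.
move=> ha hj h; rewrite /expected; case: eqP => // /eqP a0.
have hp : a.-1 %/ (r * r) < a.
  by apply: leq_ltn_trans (leq_div _ _) _; rewrite prednK // lt0n.
have r0 := node_gt0 ha a0.
rewrite /upd; case: eqP => _; last by rewrite (fut_same (h _ hp)).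
rewrite (win_same (h _ hp)) //.
by rewrite ltnW // ltn_divLR // ltn_pmod // muln_gt0 r0.
Qed.

(* Invariant of the record of node [a] at vertex [v] after the first [k] arcs. *)
Definition node_inv (M : nat -> nat) q a k v : Prop :=
  let X j := fut M q.+1 v a j.+1 in
  [/\ touched v k -> forall j, j < r -> X j = expected M q.+1 v a j,
      ~ touched v k -> fresh M q.+1 v a,
      win M q.+1 v a 0 != 0 -> found r col (walk q.+1 v) (win M q.+1 v) a X
    & win M q.+1 v a 0 = 0 -> forall i h, i < k -> ev i = v -> walk q (eu i) h ->
        extendable v h -> clash r col (nth 0 (v.+1 :: h)) X].

Lemma node_inv_same M M' q a k v : a < N ->
  (forall a', a' <= a -> same_record M M' q.+1 v a') ->
  node_inv M q a k v -> node_inv M' q a k v.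
Proof.
move=> ha h [h1 h2 h3 h4]; have ha' := h a (leqnn _).
have eX j : j < r -> fut M q.+1 v a j.+1 = fut M' q.+1 v a j.+1 by move=> hj; rewrite (fut_same ha').
have eA i : i <= r -> win M q.+1 v a i = win M' q.+1 v a i by move=> hi; rewrite (win_same ha').
split.
- move=> ht j hj; rewrite -eX // h1 // (@expected_same M M') // => a' ha''; exact: h (ltnW ha'').
- by move=> ht y hy; rewrite ha' // h2.
- by rewrite -eA // => hw; apply: found_eq (h3 hw).
- by rewrite -eA // => hw i hh hi he hv hx; apply: clash_eqr (h4 hw _ _ hi he hv hx).
Qed.

Lemma node_inv0 M q a v : fresh M q.+1 v a -> node_inv M q a 0 v.
Proof.
move=> h; split=> //; first by case.
by rewrite (win_same h).
Qed.

Lemma same_recordC M M' q v a q' v' a' :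
  (forall y, y < addr q v a \/ addr q v a + w <= y -> M' y = M y) ->
  idx q v a < idx q' v' a' \/ idx q' v' a' < idx q v a ->
  same_record M M' q' v' a'.
Proof.
move=> h hi y /andP[y1 y2]; apply: h; case: hi => hi; have := addr_lt hi; lia.
Qed.

Lemma other_record M M' q v a v' a' :
  (forall y, y < addr q v a \/ addr q v a + w <= y -> M' y = M y) ->
  v < n -> v' < n -> a < N -> a' < N -> (v', a') != (v, a) -> same_record M M' q v' a'.
Proof.
move=> h hv hv' ha ha' hne; apply: (same_recordC h).
have [lt|lt|e] := ltngtP v v'; [left; exact: idx_lt_v|right; exact: idx_lt_v|].
have [lt'|lt'|e'] := ltngtP a a'; [left; rewrite e; exact: idx_lt_a|right; rewrite e; exact: idx_lt_a|].
by rewrite e e' eqxx in hne.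
Qed.

(** Only the record of ([ev k], [a]) changes. If an earlier arc entered this vertex, its future is
    rewritten with the same values, so the certificates of the earlier arcs remain valid; otherwise
    there are none to preserve. *)
Lemma node_inv_step S q a k (M := ram S) (S' := den process_arc S) (M' := ram S') :
  env S -> ram_ok M -> var S V.q = q -> var S V.a = a -> var S V.k = k ->
  a < N -> k < m ->
  (forall v, v < n -> tree r col (walk q v) (win M q v) r 0 (fun=> 0)) ->
  (forall v, v < n -> node_inv M q a k v) ->
  [/\ ram_ok M',
      forall y, y < addr q.+1 (ev k) a \/ addr q.+1 (ev k) a + w <= y -> M' y = M y,
      forall v, v < n -> node_inv M' q a k.+1 v
    & (win M' q.+1 (ev k) a 0 = win M q.+1 (ev k) a 0 /\ var S' V.acc = var S V.acc) \/
      (exists h, walk q.+1 (ev k) h) /\ var S' V.acc = (if ev k == t then 1 else var S V.acc)].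
Proof.
move=> h hM hq ha hk haN hkm hT hN.
have un : eu k < n by apply: eu_lt.
have vn : ev k < n by apply: ev_lt.
have [hM' hout f0 fj hres] := process_arcE h hM hq ha hk haN hkm (hT _ un).
rewrite -/S' -/M' in hM' hout f0 fj hres.
have hrec v a' : v < n -> a' < N -> (v, a') != (ev k, a) -> same_record M M' q.+1 v a'.
  by move=> *; apply: other_record hout _ _ _ _ _.
split=> //; last first.
  case: hres => [[hw [hacc _]]|[_ [[h' hh' _] _] hacc]]; first by left; split=> //; exact: hw.
  by right; split=> //; exists h'.
move=> v hv.
have [ev_v|ne] := eqVneq v (ev k); last first.
  have [h1 h2 h3 h4] : node_inv M' q a k v.
    apply: node_inv_same (hN v hv) => // a' ha'; apply: hrec => //; first exact: leq_ltn_trans haN.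
    by apply: contraNneq ne => -[-> _].
  have ht : touched v k.+1 -> touched v k.
    move=> [i]; rewrite ltnS leq_eqVlt => /orP[/eqP->|hi] e; first by rewrite e eqxx in ne.
    by exists i.
  split=> //.
  - by move=> /ht; exact: h1.
  - by move=> nt; apply: h2 => -[i hi e]; apply: nt; exists i => //; exact: ltnW.
  - move=> hw i hh hi e; apply: h4 => //; move: hi; rewrite ltnS leq_eqVlt => /orP[/eqP ei|//].
    by rewrite -e ei eqxx in ne.
rewrite {v}ev_v in hv *.
have [h1 h2 h3 h4] := hN _ vn.
have hpar a' : a' < a -> same_record M M' q.+1 (ev k) a'.
  move=> ha'; apply: hrec => //; first exact: ltn_trans haN.
  by apply/eqP => -[e]; rewrite e ltnn in ha'.
have hX j : j < r -> fut M' q.+1 (ev k) a j.+1 = expected M' q.+1 (ev k) a j.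
  move=> hj; rewrite fj // (@expected_same M M') // /expected; case: eqP => // a0.
  case: (touchedP (ev k) k) => ht; first by rewrite h1 // /expected a0.
  by rewrite (fut_same (h2 ht)).
have hXX j : touched (ev k) k -> j < r -> fut M q.+1 (ev k) a j.+1 = fut M' q.+1 (ev k) a j.+1.
  by move=> ht hj; rewrite hX // h1 // (@expected_same M M').
split=> //.
- by case; exists k.
- move=> hw; case: hres => [[hwin _]|[_ //]].
  rewrite hwin // in hw.
  have ht : touched (ev k) k.
    by case: (touchedP (ev k) k) => // /h2 hf; rewrite (win_same hf) in hw.
  by apply: found_eq (h3 hw) => [i hi|j hj]; [rewrite hwin|exact: hXX].
- move=> hw i hh; case: hres => [[hwin [_ hres]]|[hw']]; last by rewrite hw in hw'.
  rewrite ltnS leq_eqVlt => /orP[/eqP->|hi] e; first by move=> *; apply: hres.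
  rewrite hwin // in hw => h5 h6.
  have ht : touched (ev k) k by exists i.
  by apply: clash_eqr (h4 hw i hh hi e h5 h6) => j; exact: hXX.
Qed.

Hypothesis t_lt : t < n.

(* [acc0] is the value of the accepting register before the layers are built. *)
Definition acc_inv acc0 q (M : nat -> nat) acc : Prop :=
  [/\ acc != 0 -> acc0 != 0 \/ exists q' h, 0 < q' <= l /\ walk q' t h,
      acc0 != 0 -> acc != 0,
      forall q' h, 0 < q' <= q -> walk q' t h -> acc != 0
    & forall a, a < N -> win M q.+1 t a 0 != 0 -> acc != 0].

Record core acc0 q (S : state) : Prop := Core {
  core_env : env S;
  core_ram : ram_ok (ram S);
  core_q : var S V.q = q;
  core_tree : forall v, v < n -> tree r col (walk q v) (win (ram S) q v) r 0 (fun=> 0);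
  core_high : forall y, addr q.+2 0 0 <= y -> ram S y = 0;
  core_acc : acc_inv acc0 q (ram S) (var S V.acc)
}.

Definition done_before (M : nat -> nat) q a :=
  forall v a', v < n -> a' < a -> node_inv M q a' m v.

Definition fresh_from (M : nat -> nat) q a :=
  forall v a', v < n -> a <= a' -> a' < N -> fresh M q.+1 v a'.

Lemma core_set acc0 q S x y : x \notin [:: V.acc, V.q & params] ->
  core acc0 q S -> core acc0 q (set_var S x y).
Proof.
rewrite !inE !negb_or => /andP[x0 /andP[xq hx]] [h1 h2 h3 h4 h5 h6].
split; rewrite ?ram_set ?var_set ?(eq_sym _ x) ?(negbTE x0) ?(negbTE xq) //.
by apply: env_set => //; rewrite !inE !negb_or.
Qed.

Lemma arc_step acc0 q a k S (S' := set_var (den process_arc S) V.k k.+1) :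
  core acc0 q S -> q < l -> var S V.a = a -> var S V.k = k -> a < N -> k < m ->
  done_before (ram S) q a -> fresh_from (ram S) q a.+1 ->
  (forall v, v < n -> node_inv (ram S) q a k v) ->
  [/\ core acc0 q S', var S' V.a = a, done_before (ram S') q a, fresh_from (ram S') q a.+1
    & forall v, v < n -> node_inv (ram S') q a k.+1 v].
Proof.
move=> [h1 h2 h3 h4 h5 h6] hq ha hk haN hkm hb hf hc.
have [g1 g2 g3 g4] := node_inv_step h1 h2 h3 ha hk haN hkm h4 hc.
have vn : ev k < n by apply: ev_lt.
have rS' : ram S' = ram (den process_arc S) by exact: ram_set.
have hrec v a' : v < n -> a' < N -> a' != a -> same_record (ram S) (ram S') q.+1 v a'.
  move=> hv ha' ne; rewrite rS'; apply: other_record g2 _ _ _ _ _ => //.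
  by apply: contraNneq ne => -[_ ->].
split.
- apply: core_set => //; split=> //.
  + exact: env_den.
  + by rewrite var_den.
  + move=> v hv; apply: tree_eq (h4 v hv) => b i hbN hi; rewrite /win g2 //; left.
    have := addr_lt (idx_lt_q (ev k) a (ltnSn q) hv hbN).
    rewrite /w; lia.
  + move=> y hy; rewrite g2 ?h5 //; right; apply: leq_trans hy.
    exact: addr_lt (idx_lt_q _ _ (ltnSn _) vn haN).
  + case: h6 => c1 c2 c3 c4; split.
    * case: g4 => [[_ ->]//|[[h hh] ->]]; case: (ev k =P t) => [<- _|_ //].
      by right; exists q.+1, h.
    * by case: g4 => [[_ ->]//|[_ ->]]; case: (ev k =P t).
    * by move=> q' h' hq' hh'; case: g4 => [[_ ->]|[_ ->]]; [|case: (ev k =P t) => // _]; apply: c3 hh'.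
    * move=> a' ha'.
      have [e|ne] := eqVneq (t, a') (ev k, a); last first.
        rewrite (@win_same (ram S) _ _ _ _ 0) // => [hw|].
          by have := c4 a' ha' hw; case: g4 => [[_ ->]|[_ ->]] //; case: (ev k =P t).
        exact: other_record g2 _ _ _ _ ne.
      case: e => et ->; case: g4 => [[e1 ->]|[_ ->]]; last by rewrite et eqxx.
      by rewrite et e1 -et; apply: c4.
- by rewrite var_set /= var_den.
- move=> v a' hv ha'; have ha'N := ltn_trans ha' haN.
  apply: node_inv_same (hb v a' hv ha') => // a2 ha2; apply: hrec => //.
    exact: leq_ltn_trans ha'N.
  by apply/eqP => e; rewrite e leqNgt ha' in ha2.
- move=> v a' hv ha' ha'N y hy.
  by rewrite (hrec v a') // ?(hf v a') //; apply/eqP => e; rewrite e ltnn in ha'.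
- by move=> v hv; rewrite rS'; exact: g3.
Qed.

Lemma arc_loop acc0 q a S (S' := set_var (den (For V.k V.m process_arc) S) V.a a.+1) :
  core acc0 q S -> q < l -> var S V.a = a -> a < N ->
  done_before (ram S) q a -> fresh_from (ram S) q a ->
  [/\ core acc0 q S', done_before (ram S') q a.+1 & fresh_from (ram S') q a.+1].
Proof.
move=> hc hq ha haN hb hf.
have := @loop_ind (fun k S => [/\ core acc0 q S, var S V.a = a, done_before (ram S) q a,
    fresh_from (ram S) q a.+1 & forall v, v < n -> node_inv (ram S) q a k v]) V.k V.m process_arc S isT.
have he : env S := core_env hc.
rewrite (he V.m isT : _ = m) => -[].
- split=> //; first exact: core_set.
    by move=> v a' hv ha'; apply: hf => //; exact: ltnW.
  by move=> v hv; apply: node_inv0; apply: hf.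
- move=> k s' hk ek hy [i1 i2 i3 i4 i5]; exact: arc_step.
move=> i1 i2 i3 i4 i5; split=> //; first exact: core_set.
move=> v a' hv; rewrite ltnS leq_eqVlt => /orP[/eqP->|ha']; first exact: i5.
exact: i3.
Qed.

Lemma walkS q v h : walk q.+1 v h ->
  exists k h', [/\ k < m, ev k = v, walk q (eu k) h', extendable v h' & h = v.+1 :: h'].
Proof.
move=> H; inversion H as [|q' k h' hk hw hx e1 e2 e3].
by exists k, h'.
Qed.

Lemma child_divmod b i j : i < r -> j < r ->
  [/\ (child r b i j).-1 %/ (r * r) = b, (child r b i j).-1 %% (r * r) %/ r = i
    & (child r b i j).-1 %% (r * r) %% r = j].
Proof.
move=> hi hj; have -> : (child r b i j).-1 = b * (r * r) + (i * r + j) by rewrite /child; lia.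
have hij : i * r + j < r * r.
  by apply: (@leq_trans (i.+1 * r)); [rewrite mulSn; lia|rewrite leq_mul2r hi orbT].
have r0 : 0 < r by apply: leq_ltn_trans hi.
rewrite divnMDl ?muln_gt0 ?r0 // modnMDl (divn_small hij) (modn_small hij) addn0.
by rewrite divnMDl // modnMDl (divn_small hj) (modn_small hj) addn0.
Qed.

(** A walk of length q + 1 to [v] has a last arc, so the certificates of all arcs together cover all
    walks. *)
Lemma layer_tree M q v : v < n -> done_before M q N ->
  tree r col (walk q.+1 v) (win M q.+1 v) r 0 (fun=> 0).
Proof.
move=> hv hd.
apply: (@tree_build _ _ _ _ (fun b j => fut M q.+1 v b j.+1)) => [b hb|b i j hch hA hi hj y hy|j hj].
- have [h1 h2 h3 h4] := hd v b hv hb.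
  rewrite /node_ok; case: eqP => [e h|/eqP ne]; last exact: h3.
  by move=> /walkS[k [h' [hk e' hw hx ->]]]; apply: h4 hw hx.
- have hb : b < N.
    apply: leq_ltn_trans hch; have : b <= b * (r * r).
      by rewrite leq_pmulr // muln_gt0 (leq_ltn_trans _ hi).
    by rewrite /child; move: (b * _) => z; clear; lia.
  have [h1 h2 h3 h4] := hd v _ hv hch.
  have [_ _ g3 _] := hd v b hv hb.
  (* The label of [b] comes from a walk whose last arc enters [v]; hence [v] is touched and the
     future of the child has been written. *)
  have [[h /walkS[k [_ [hk e _ _ _]]] _] _] := g3 hA.
  have ht : touched v m by exists k.
  rewrite h1 // /expected; have [-> -> ->] := child_divmod b hi hj.
  by case: eqP => // e0; rewrite /child in e0; lia.
- have N0 : 0 < N by rewrite /N /=; lia.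
  have [h1 h2 h3 h4] := hd v 0 hv N0.
  case: (touchedP v m) => ht; first by rewrite h1.
  by rewrite (fut_same (h2 ht)).
Qed.

Record layer_inv acc0 q (S : state) : Prop := LayerInv {
  layer_env : env S;
  layer_ram : ram_ok (ram S);
  layer_trees : forall v, v < n -> tree r col (walk q v) (win (ram S) q v) r 0 (fun=> 0);
  layer_high : forall y, addr q.+1 0 0 <= y -> ram S y = 0;
  layer_acc : acc_inv acc0 q (ram S) (var S V.acc)
}.

Lemma addr_le q v a : addr q 0 0 <= addr q v a.
Proof. by rewrite /addr leq_add2l leq_mul2r /idx; apply/orP; right; rewrite leq_add // leq_mul2r leq_add2l orbT. Qed.

Lemma high_fresh M q v a : (forall y, addr q 0 0 <= y -> M y = 0) -> fresh M q v a.
Proof. by move=> h y /andP[hy _]; rewrite h //; apply: leq_trans (addr_le _ _ _) hy. Qed.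

Lemma layer_step acc0 q S (S' := set_var (den (For V.a V.N (For V.k V.m process_arc)) S) V.q q.+1) :
  layer_inv acc0 q S -> var S V.q = q -> q < l -> layer_inv acc0 q.+1 S'.
Proof.
move=> [h1 h2 h3 h4 h5] hq hql.
have hn : 0 < n by apply: leq_ltn_trans s_lt.
have N0 : 0 < N by rewrite /N /=; lia.
have hc : core acc0 q S.
  split=> // y hy; apply: h4; apply: leq_trans hy.
  apply: leq_trans (leq_addr w _) _; exact: addr_lt (idx_lt_q 0 0 (ltnSn _) hn N0).
have := @loop_ind (fun a S => [/\ core acc0 q S, done_before (ram S) q a & fresh_from (ram S) q a])
   V.a V.N (For V.k V.m process_arc) S isT.
rewrite (h1 V.N isT : _ = N) => -[].
- split; [exact: core_set|by []|].
  by move=> v a hv _ ha; apply: high_fresh.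
- by move=> a s' ha ea hy [i1 i2 i3]; apply: arc_loop.
move=> [g1 g2 g3 g4 g5 g6] hd _.
split; rewrite ?ram_set ?var_set //=; first exact: env_set.
  by move=> v hv; apply: layer_tree.
case: g6 => c1 c2 c3 c4; split=> //; last first.
  by move=> a ha; rewrite (win_same (@high_fresh _ _ t a g5)).
move=> q' h /andP[q0]; rewrite leq_eqVlt => /orP[/eqP->|hq'] hw; last by apply: c3 hw; rewrite q0.
(* The root assumes nothing, so no walk conflicts with it: it is labelled as soon as a walk to [t]
   exists. *)
have [_ hok] := tree_node (layer_tree t_lt hd).
apply: (c4 0) => //; apply/negP => e; move: hok; rewrite /node_ok e => /(_ _ hw)[i [j]].
by rewrite /conf eqxx !andbF.
Qed.

(** The trivial walk is the only one of length 0, so only the root of [s] needs a label. Its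
    children that a search can reach assume the color of [s] at some position j, where the trivial
    walk conflicts; leaving them unlabelled is correct. *)
Lemma first_layer M v : v < n -> (forall y, base <= y -> M y = if y == addr 0 s 0 then s.+1 else 0) ->
  tree r col (walk 0 v) (win M 0 v) r 0 (fun=> 0).
Proof.
move=> hv hM.
have N0 : 0 < N by rewrite /N /=; lia.
have hwin b i : b < N -> i <= r -> win M 0 v b i = if (b == 0) && (i == 0) && (v == s) then s.+1 else 0.
  move=> hb hi; rewrite /win hM; last exact: base_win.
  case: (ltngtP (idx 0 v b) (idx 0 s 0)) => h.
  - have := addr_lt h; case: eqP => [|_ _]; first by rewrite /w; lia.
    case: ifP => // /andP[/andP[/eqP e1 _] /eqP e2]; by rewrite e1 e2 ltnn in h.
  - have := addr_lt h; case: eqP => [|_ _]; first by rewrite /w; lia.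
    case: ifP => // /andP[/andP[/eqP e1 _] /eqP e2]; by rewrite e1 e2 ltnn in h.
  - rewrite /addr h -[X in _ == X]addn0 eqn_add2l.
    have [e|ne] := eqVneq v s; last first.
      have [lt|lt|e] := ltngtP v s; last by rewrite e eqxx in ne.
        by have := idx_lt_v 0 0 lt hb; rewrite h ltnn.
      by have := idx_lt_v 0 b lt N0; rewrite h ltnn.
    have -> : b = 0 by move: h; rewrite e /idx; lia.
    by rewrite eqxx andbT.
have sub d b X : b < N -> b != 0 \/ v != s -> (forall h, walk 0 v h -> clash r col (nth 0 h) X) ->
    tree r col (walk 0 v) (win M 0 v) d b X.
  move=> hb hbv hX.
  have e0 : win M 0 v b 0 = 0.
    by rewrite hwin // andbT; case: hbv => /negbTE->; rewrite ?andbF.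
  by case: d => [|d]; split=> //; rewrite ?/node_ok e0.
have [e|ne] := eqVneq v s; last first.
  apply: sub => //; first by right.
  by move=> h H; inversion H as [e1 e2 e3|]; rewrite e2 eqxx in ne.
rewrite {v}e in hv hwin sub *.
have w0 h : walk 0 s h -> h = [:: s.+1] by move=> H; inversion H.
suff [g1 [g2 g3]] : 0 < N /\ node_ok r col (walk 0 s) (win M 0 s) 0 (fun=> 0) /\
   (forall d i j, i + j < r -> win M 0 s 0 i != 0 ->
     tree r col (walk 0 s) (win M 0 s) d (child r 0 i j) (upd (fun=> 0) j (win M 0 s 0 i))).
  have g d : tree r col (walk 0 s) (win M 0 s) d 0 (fun=> 0).
    by case: d => [|d]; split=> // i j hij _ hA _; apply: g3.
  exact: g.
split=> //; split.
  rewrite /node_ok hwin // !eqxx /=; split.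
    exists [:: s.+1]; first by constructor.
    by move=> i hi; rewrite hwin // !eqxx; case: i hi => [|i] //= _; rewrite nth_nil.
  by case=> i [j]; rewrite /conf eqxx !andbF.
move=> d i j hij; rewrite hwin //; last lia.
have [->|//] := eqVneq i 0; rewrite !eqxx /= => _.
have hch : child r 0 0 j < N.
  apply: leq_trans (leq_tree_size r (_ : 2 <= r.+1)); last lia.
  by apply: child_lt; rewrite ?addn1 //=; lia.
apply: sub => //; first by left; rewrite /child; lia.
move=> h /w0->; exists 0, j; apply/and4P; rewrite /= upd_eq; split=> //; lia.
Qed.

Lemma layersE S (S' := den layers S) : env S -> ram_ok (ram S) ->
  (forall y, base <= y -> ram S y = 0) ->
  [/\ env S', forall y, y < base -> ram S' y = inp y,
      forall y, addr l.+1 0 0 <= y -> ram S' y = 0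
    & var S' V.acc != 0 <->
      var S V.acc != 0 \/ exists q h, 0 < q <= l /\ walk q t h].
Proof.
move=> h hM h0; rewrite {}/S' /layers den_seq den_wr addrE //.
set S1 := State _ _.
have hn : 0 < n by apply: leq_ltn_trans s_lt.
have N0 : 0 < N by rewrite /N /=; lia.
have r1 : ram S1 = upd (ram S) (addr 0 s 0) s.+1.
  by rewrite /S1 /= (h V.s isT : _ = s) addn1.
have h1 : env S1 by [].
have a1 : var S1 V.acc = var S V.acc by [].
move: S1 r1 h1 a1 => S1 r1 h1 a1.
have hl : layer_inv (var S V.acc) 0 S1.
  have hlt := addr_lt (idx_lt_q 0 0 (ltnSn 0) s_lt N0).
  have high y : addr 1 0 0 <= y -> ram S1 y = 0.
    move=> hy; rewrite r1 upd_neq ?h0 //; first by have := base_addr 1 0 0; lia.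
    by apply/eqP; rewrite /w in hlt; lia.
  split=> //.
  - by rewrite r1; apply: ram_ok_upd => //; exact: base_addr.
  - move=> v hv; apply: first_layer => // y hy; rewrite r1 /upd; case: eqP => // _; exact: h0.
  - split; rewrite a1 //; [by left|by move=> q' h' /andP[]; case: q'|].
    by move=> a ha; rewrite (win_same (@high_fresh _ _ t a high)).
set c := For V.a _ _.
have := @loop_ind (fun q S2 => layer_inv (var S V.acc) q S2) V.q V.l c S1 isT.
rewrite (h1 V.l isT : _ = l) => -[].
- by case: hl => g1 g2 g3 g4 g5; split=> //; exact: env_set.
- by move=> q s' hq eq _ hi; apply: layer_step.
move=> g1 [g2 _] g3 g4 [c1 c2 c3 c4]; split=> //.
split=> //; case=> // -[q [h' [hq hw]]]; exact: c3 hw.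
Qed.
End Layers.

Lemma valid_le n r col m s eu ev q v h :
  s < n -> (forall k, k < m -> ev k < n) ->
  valid r col m s eu ev q v h -> forall i, nth 0 h i <= n.
Proof.
move=> hs hev; elim=> [|{}q k {}h hk _ IH _] [|i] //=; first by rewrite nth_nil.
exact: hev.
Qed.

Lemma valid_eq n r col col' m s eu eu' ev ev' q v h :
  s < n -> (forall k, k < m -> ev k < n) ->
  (forall k, k < m -> eu k = eu' k) -> (forall k, k < m -> ev k = ev' k) ->
  (forall x, x <= n -> col x = col' x) ->
  valid r col m s eu ev q v h -> valid r col' m s eu' ev' q v h.
Proof.
move=> hs hev e1 e2 ec; elim=> [|{}q k {}h hk hv IH hx]; first exact: valid0.
rewrite e2 //; rewrite e1 // in IH; apply: validS => // i hi his.
have hn := valid_le hs hev hv i.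
by rewrite -e2 // -!ec ?hx //; apply: hev.
Qed.

Lemma den_count_nodes S r (S' := den count_nodes S) : var S V.r = r ->
  [/\ ram S' = ram S, var S' V.r2 = r * r, var S' V.w = r + r + 2
    & var S' V.N = tree_size r r.+1].
Proof.
move=> hr; rewrite {}/S' /count_nodes !den_seq !den_asg.
set S1 := set_var S _ _; set S2 := set_var S1 _ _; set S3 := set_var S2 _ _.
have r3 : var S3 V.r = r by rewrite !var_set.
have e3 : var S3 V.r2 = r * r by rewrite !var_set /= hr.
set c := Asg _ _.
have := @loop_ind (fun k s => ram s = ram S /\ var s V.N = tree_size r k.+1) V.c V.r c S3 isT.
rewrite r3 => -[]; first by split=> //; rewrite !var_set.
  move=> k s' hk ek hy [i1 i2]; rewrite ram_set var_set /= /c den_asg ram_set var_set /=.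
  by rewrite i2 hy // e3.
move=> -> ->; split=> //; rewrite var_den //.
by rewrite !var_set /= !var_set /= hr.
Qed.

(** Generous degrees that pass the check [cdeg_ok] for all parts of the algorithm except the loop
    computing [N]. [N] has degree 1 because X will be chosen at least as large as it. *)
Definition var_deg (x : nat) : nat :=
  nth 1 [:: 1; 1; 1; 1; 1; 1; 1; 1; 1; 16; 1; 2; 6; 1; 1; 1; 1; 1; 1; 1; 1; 1; 1;
            40; 40; 1; 20] x.

Lemma den_for i x c s : den (For i x c) s = loop_state i c (var s x) s.
Proof. by []. Qed.

(** No fixed degree survives the static check of a loop that multiplies [N] by r^2; instead, its
    intermediate values are sizes of smaller trees and so at most the final one. *)
Lemma count_nodes_bounded X S r :
  1 < X -> bounded X var_deg 2 S -> var S V.r = r -> tree_size r r.+1 <= X ->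
  bounded X var_deg 2 (den count_nodes S) /\ safe (X ^ 60) count_nodes S.
Proof.
move=> hX hS hr hN.
pose c0 : cmd := (V.r2 ::= #V.r * #V.r;; V.w ::= #V.r + #V.r + `2;; V.N ::= `1)%prog.
have [b0 s0] := @safe_deg X var_deg 2 60 hX c0 S isT isT hS.
set c : cmd := (V.N ::= #V.N * #V.r2 + `1)%prog.
have -> : den count_nodes S = den (For V.c V.r c) (den c0 S) by rewrite !den_seq.
have hs : safe (X ^ 60) (For V.c V.r c) (den c0 S) -> safe (X ^ 60) count_nodes S.
  by rewrite !den_seq => h; case: s0 => s1 [s2 s3]; exact: (conj s1 (conj s2 (conj s3 h))).
set S3 := den c0 S in b0 hs *.
have r3 : var S3 V.r = r by rewrite var_den.
have e3 : var S3 V.r2 = r * r.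
  by rewrite /S3 !den_seq !den_asg !var_set /= hr.
have N3 : var S3 V.N = 1 by rewrite /S3 !den_seq !den_asg var_set.
have X0 : 0 < X := ltnW hX.
have hr1 : r <= X by have := b0.1 V.r isT; rewrite r3 expn1.
have H k : k <= r -> bounded X var_deg 2 (loop_state V.c c k S3) /\
     var (loop_state V.c c k S3) V.N = tree_size r k.+1.
  elim: k => [|k IH] hk.
    rewrite /loop_state /=; split; last by rewrite var_set N3.
    split=> [x hx|a]; last exact: b0.2.
    by rewrite var_set; case: eqP => // _; apply: b0.1.
  have [[b1 b2] e] := IH (ltnW hk).
  have hk1 : tree_size r k.+2 <= X by apply: leq_trans hN; apply: leq_tree_size.
  have e2 : var (loop_state V.c c k S3) V.r2 = r * r by rewrite var_loop_state.
  have ec : var (loop_state V.c c k S3) V.c = k by rewrite loop_state_index.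
  have -> : loop_state V.c c k.+1 S3 =
     set_var (set_var (loop_state V.c c k S3) V.N (tree_size r k.+2)) V.c k.+1.
    by rewrite {1}/loop_state iterS -/(loop_state V.c c k S3) /loop_body /c den_asg var_set /= ec e e2.
  split; last by rewrite !var_set.
  split=> [x hx|a]; last exact: b2.
  rewrite var_set; case: eqP => [->|_]; first by rewrite expn1; exact: leq_trans hk hr1.
  by rewrite var_set; case: eqP => [->|_]; [rewrite expn1|exact: b1].
split; first by rewrite den_for r3; apply: (H r (leqnn _)).1.
apply: hs => k; rewrite r3 => hk.
have [[b1 b2] e] := H k (ltnW hk).
have e2 : var (loop_state V.c c k S3) V.r2 = r * r by rewrite var_loop_state.
have hk1 : tree_size r k.+2 <= X by apply: leq_trans hN; apply: leq_tree_size.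
have XX : X <= X ^ 60 by rewrite -{1}[X]expn1 leq_pexp2l.
rewrite /c /= e e2 -[tree_size r k.+1 * (r * r) + 1]/(tree_size r k.+2).
have l1 : tree_size r k.+2 <= X ^ 60 by apply: leq_trans hk1 XX.
have l2 : tree_size r k.+1 <= X ^ 60 by apply: leq_trans l1; apply: leq_tree_size.
have l3 : tree_size r k.+1 * (r * r) <= X ^ 60 by apply: leq_trans l1; rewrite leq_addr.
have l4 : r * r <= X ^ 60.
  apply: leq_trans (leq_mul hr1 hr1) _; rewrite mulnn leq_pexp2l //.
by do !split=> //; rewrite expn_gt0 X0.
Qed.

(** * The two runs together *)

Section Algorithm.

Variable inp : nat -> nat.
Let n := inp 0.
Let m := inp 1.
Let s := inp 2.
Let t := inp 3.
Let r := inp 4.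
Let l := inp 5.
Let eu k := inp (6 + n + (k + k)).
Let ev k := inp (7 + n + (k + k)).
Let col x := inp (5 + x).
Let g := State (fun=> 0) inp.
Let N := tree_size r r.+1.

Hypothesis eu_lt : forall k, k < m -> eu k < n.
Hypothesis ev_lt : forall k, k < m -> ev k < n.
Hypothesis s_lt : s < n.
Hypothesis t_lt : t < n.
Hypothesis inp_high : forall y, 6 + n + m + m <= y -> inp y = 0.

Lemma bounded_start X : 1 < X -> (forall y, inp y <= X) -> bounded X (fun=> 1) 1 g.
Proof. by move=> hX h; split=> [x _|a] //=; rewrite expn1. Qed.

Let S1 := den prelude g.

Lemma preludeE : [/\ ram S1 = inp, var S1 V.n = n /\ var S1 V.m = m,
  var S1 V.s = s /\ var S1 V.t = t, var S1 V.r0 = r /\ var S1 V.l0 = l & var S1 V.acc = 0].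
Proof. by rewrite /S1 /prelude !den_seq !den_asg !var_set /= !ram_set. Qed.

Let rA := 0.
Let lA := minn l (r - 1).
Let baseA := 6 + n + m + m.
Let S2 := den short_params S1.
Let S3 := den count_nodes S2.
Let S4 := den layers S3.
Let baseB := 6 + n + m + m + (l + 1) * n * 2.
Let S5 := den long_params S4.
Let S6 := den count_nodes S5.
Let S7 := den layers S6.

Lemma den_algorithm : den algorithm g = if l == 0 then S1 else S7.
Proof.
have [_ _ _ [_ el] _] := preludeE.
rewrite /algorithm (den_seq prelude) -/S1 den_if [eval _ _]el; case: (l == 0); first by [].
by rewrite (den_seq short_params) (den_seq count_nodes) (den_seq layers) (den_seq long_params) (den_seq count_nodes).
Qed.

Lemma S2E : [/\ ram S2 = inp, var S2 V.r = rA, var S2 V.l = lA, var S2 V.base = baseA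
   & forall x, x \notin assigned short_params -> var S2 x = var S1 x].
Proof.
have [eM [en em] [es et] [er el] _] := preludeE.
have f x : x \notin assigned short_params -> var S2 x = var S1 x by exact: var_den.
rewrite /S2 /short_params !den_seq !den_asg !ram_set; split=> //; by rewrite !var_set /= ?var_set /= ?el ?er ?en ?em.
Qed.

Lemma env3 : env n m s t rA lA baseA S3.
Proof.
have [_ [en em] [es et] _ _] := preludeE.
have [eM er el eb f] := S2E; have [cM c1 c2 c3] := den_count_nodes er.
move=> x; rewrite !inE; do !(move=> /orP[/eqP->|]); try move/eqP->; rewrite ?c1 ?c2 ?c3 //.
all: by rewrite var_den // ?f.
Qed.

Definition short_walk := exists q h, 0 < q <= lA /\ valid 0 col m s eu ev q t h.

Lemma S4E : [/\ env n m s t rA lA baseA S4, forall y, y < baseA -> ram S4 y = inp y,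
   forall y, baseB <= y -> ram S4 y = 0 & var S4 V.acc != 0 <-> short_walk].
Proof.
have [_ _ _ _ e0] := preludeE.
have [eM er el eb f] := S2E; have [cM c1 c2 c3] := den_count_nodes er.
have eM3 : ram S3 = inp by rewrite cM.
have := @layersE n m s t rA lA baseA inp (leqnn _) eu_lt ev_lt s_lt t_lt S3 env3.
rewrite eM3 => -[]; first by split=> // y hy; rewrite inp_high.
  exact: inp_high.
move=> h1 h2 h3 h4; split=> //.
  move=> y hy; apply: h3; apply: leq_trans hy.
  have -> : addr n rA baseA lA.+1 0 0 = baseA + lA.+1 * n * 2 by rewrite /addr /idx /rA /= !addn0 !muln1.
  by rewrite leq_add2l !leq_mul2r addn1 ltnS geq_minl !orbT.
rewrite -/S4 in h4; rewrite h4; have -> : var S3 V.acc = 0 by rewrite var_den // f.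
by split=> [[]//|h]; right.
Qed.

Lemma S5E : [/\ ram S5 = ram S4, var S5 V.r = r, var S5 V.l = l, var S5 V.base = baseB
   & forall x, x \notin assigned long_params -> var S5 x = var S4 x].
Proof.
have [h1 h2 h3 h4] := S4E.
have [_ _ _ [e_r e_l] _] := preludeE; have [_ _ _ _ f2] := S2E.
have r4 : var S4 V.r0 = r by rewrite var_den // var_den // f2.
have l4 : var S4 V.l0 = l by rewrite var_den // var_den // f2.
have f x : x \notin assigned long_params -> var S5 x = var S4 x by exact: var_den.
rewrite /S5 /long_params !den_seq !den_asg !ram_set; split=> //; rewrite !var_set /= ?var_set /= ?r4 ?l4 //.
by rewrite (h1 V.n isT) (h1 V.m isT).
Qed.

Lemma env6 : env n m s t r l baseB S6.
Proof.
have [h1 _ _ _] := S4E.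
have [eM er el eb f] := S5E; have [cM c1 c2 c3] := den_count_nodes er.
move=> x; rewrite !inE; do !(move=> /orP[/eqP->|]); try move/eqP->; rewrite ?c1 ?c2 ?c3 //.
all: by rewrite var_den // ?f // h1.
Qed.

Definition long_walk := exists q h, 0 < q <= l /\ valid r col m s eu ev q t h.

Lemma S7E : var S7 V.acc != 0 <-> short_walk \/ long_walk.
Proof.
have [h1 h2 h3 h4] := S4E.
have [eM er el eb f] := S5E; have [cM c1 c2 c3] := den_count_nodes er.
(* The second run treats everything below its base, including what the first one left there, as
   read-only input. *)
pose inp' y := if y < baseB then ram S4 y else 0.
have hb : 6 + n + m + m <= baseB by apply: leq_addr.
have e y : y < 6 + n + m + m -> inp' y = inp y.
  by move=> hy; rewrite /inp' h2 // (leq_trans hy hb).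
have eu' k : k < m -> inp' (6 + n + (k + k)) = eu k by move=> hk; apply: e; lia.
have ev' k : k < m -> inp' (7 + n + (k + k)) = ev k by move=> hk; apply: e; lia.
have ec' x : x <= n -> inp' (5 + x) = col x by move=> hx; apply: e; lia.
have eu2 k : k < m -> inp' (6 + n + (k + k)) < n by move=> hk; rewrite eu' // eu_lt.
have ev2 k : k < m -> inp' (7 + n + (k + k)) < n by move=> hk; rewrite ev' // ev_lt.
have := @layersE n m s t r l baseB inp' hb eu2 ev2 s_lt t_lt S6 env6.
have -> : ram S6 = ram S4 by rewrite cM.
have -> : var S6 V.acc = var S4 V.acc by rewrite var_den // f.
move=> [].
- by split=> y hy; [rewrite /inp' hy|rewrite h3].
- exact: h3.
move=> _ _ _; rewrite -/S7 => ->; rewrite h4.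
split=> -[hs|[q [h [hq hv]]]]; [by left|right|by left|right]; exists q, h; split=> //.
  by apply: (@valid_eq n) hv.
apply: (@valid_eq n) hv => // [k hk|k hk|x hx].
- by rewrite eu'.
- by rewrite ev'.
- by rewrite ec'.
Qed.

Lemma algorithmE : var (den algorithm g) V.acc != 0 <-> short_walk \/ long_walk.
Proof.
rewrite den_algorithm; have [l0|_] := eqVneq l 0; last exact: S7E.
have [_ _ _ _ ->] := preludeE; split=> // -[] [q [h [hq _]]]; move: hq.
  by rewrite /lA l0; lia.
by rewrite l0; lia.
Qed.

Lemma bounded_weaken X D D' dm dm' S : 0 < X -> (forall x, x < tmp -> D x <= D' x) -> dm <= dm' ->
  bounded X D dm S -> bounded X D' dm' S.
Proof.
move=> X0 hD hd [h1 h2]; split=> [x hx|a].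
  by apply: leq_trans (h1 x hx) _; rewrite leq_pexp2l // hD.
by apply: leq_trans (h2 a) _; rewrite leq_pexp2l.
Qed.

(** For l = 0 the time bound gives no control over [N], but then the nodes are never counted. *)
Lemma algorithm_safe X : 1 < X -> (forall y, inp y <= X) -> (l != 0 -> N <= X) ->
  safe (X ^ 60) algorithm g.
Proof.
move=> hX hi hN; have X0 := ltnW hX.
have [b1 s1] := @safe_deg X (fun=> 1) 1 60 hX prelude g isT isT (bounded_start hX hi).
have [_ _ _ [_ el] _] := preludeE.
have b1' : bounded X var_deg 2 S1.
  apply: bounded_weaken b1 => // x hx; have /allP : all (fun x => 0 < var_deg x) (iota 0 tmp) by [].
  by apply; rewrite mem_iota.
split=> //; split.
  by split=> //; apply: leq_trans (b1'.1 V.l0 isT) _; rewrite leq_pexp2l.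
rewrite [eval _ _]el => /hN {}hN.
have [b2 s2] := @safe_deg X var_deg 2 60 hX short_params S1 isT isT b1'.
have [_ er2 _ _ _] := S2E; have [_ er5 _ _ _] := S5E.
have tA : tree_size rA rA.+1 <= X by rewrite /= ltnW.
have [b3 s3] := count_nodes_bounded hX b2 er2 tA.
have [b4 s4] := @safe_deg X var_deg 2 60 hX layers S3 isT isT b3.
have [b5 s5] := @safe_deg X var_deg 2 60 hX long_params S4 isT isT b4.
have [b6 s6] := count_nodes_bounded hX b5 er5 hN.
have [b7 s7] := @safe_deg X var_deg 2 60 hX layers S6 isT isT b6.
exact: (conj s2 (conj s3 (conj s4 (conj s5 (conj s6 s7))))).
Qed.

Let cube := r.+1 * r.+1 * r.+1.
Let lim x := match x with V.r => r | V.l => l | V.N => N | V.m => m | _ => 0 end.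

(** The dominating part is [descend], with r searches among r^2 pairs of positions. *)
Lemma process_arc_cost : scost lim process_arc <= 1000 * cube.
Proof.
rewrite [scost _ _]/= /cube.
have h1 := leq0n (r * r); have h2 := leq0n (r * r * r).
by move: (r) h1 h2 => x; clear; nia.
Qed.

Lemma layers_cost : 0 < m -> scost lim layers <= 1100 * (1 + l * (m * (N * cube))).
Proof.
move=> m0; have N0 : 0 < N by rewrite /N /=; lia.
have c0 : 0 < cube by [].
have -> : scost lim layers = scost lim (Wr (record_addr (Cst 0) (Var V.s) (Cst 0)) (Bin OAdd (Var V.s) (Cst 1)))
   + (3 + l * (3 + N * (3 + m * (scost lim process_arc + 6) + 6) + 6)) by [].
have hP := process_arc_cost.
have h1 : 3 + m * (scost lim process_arc + 6) + 6 <= m * (1015 * cube).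
  by move: (scost _ _) hP => P hP; clear -m0 c0 hP; nia.
have h2 : 3 + N * (3 + m * (scost lim process_arc + 6) + 6) + 6 <= m * (N * (1024 * cube)).
  move: (3 + m * (scost lim process_arc + 6) + 6) h1 => P h1.
  have : 0 < m * (N * cube) by rewrite !muln_gt0 m0 N0.
  by clear -h1; nia.
have h3 := leq_mul (leqnn l) h2.
have h4 : scost lim (Wr (record_addr (Cst 0) (Var V.s) (Cst 0)) (Bin OAdd (Var V.s) (Cst 1))) <= 60 by [].
have e : l * (m * (N * (1024 * cube))) = 1024 * (l * (m * (N * cube))) by rewrite !(mulnCA _ 1024).
rewrite e in h3; move: (l * (m * (N * cube))) (l * _) (scost _ (Wr _ _)) h3 h4 => y z x; clear; lia.
Qed.

Lemma algorithm_cost : (0 < l -> 0 < m) ->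
  cost algorithm g <= 3000 * (1 + l * (m * (N * cube))).
Proof.
move=> hm; have [_ [en1 em1] _ [er1 el1] _] := preludeE.
have cP : cost prelude g <= 100 by apply: (leq_trans (@cost_le lim prelude g isT isT _)).
have -> : cost algorithm g = cost prelude g + ((size (comp_expr (Var V.l0) tmp)).+1 +
   (if l == 0 then 0 else cost short_params S1 + (cost count_nodes S2 + (cost layers S3 +
     (cost long_params S4 + (cost count_nodes S5 + cost layers S6)))))).
  by rewrite -el1.
have [->|l0] := eqVneq l 0; first by rewrite /= in cP *; lia.
have m0 : 0 < m by apply: hm; rewrite lt0n.
have N0 : 0 < N by rewrite /N /=; lia.
have [_ er2 _ _ _] := S2E; have [_ er5 _ _ _] := S5E.
have e3 := env3; have e6 := env6.
have k1 : cost short_params S1 <= 100 by apply: (leq_trans (@cost_le lim short_params S1 isT isT _)).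
have k2 : cost long_params S4 <= 100 by apply: (leq_trans (@cost_le lim long_params S4 isT isT _)).
have kc S : var S V.r <= r -> cost count_nodes S <= 100 * r.+1.
  move=> hr; apply: (leq_trans (@cost_le lim count_nodes S isT isT _)).
    by move=> x; rewrite inE => /eqP->.
  by rewrite [scost _ _]/=; lia.
have kl S : var S V.l <= l -> var S V.N <= N -> var S V.m <= m -> var S V.r <= r ->
    cost layers S <= 1100 * (1 + l * (m * (N * cube))).
  move=> h1 h2 h3 h4; apply: leq_trans (layers_cost m0); apply: cost_le => // x.
  have : all (fun y => y \in [:: V.l; V.N; V.m; V.r]) (limits layers) by [].
  move/allP=> h /h; rewrite !inE; do !(move=> /orP[/eqP->//|]); by move/eqP->.
have q2 := kc S2; rewrite er2 in q2; have {}q2 := q2 (leq0n _).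
have q5 := kc S5; rewrite er5 in q5; have {}q5 := q5 (leqnn _).
have q3 : cost layers S3 <= 1100 * (1 + l * (m * (N * cube))).
  by apply: kl; rewrite ?(e3 V.l isT) ?(e3 V.N isT) ?(e3 V.m isT) ?(e3 V.r isT) //; exact: geq_minl.
have q6 : cost layers S6 <= 1100 * (1 + l * (m * (N * cube))).
  by apply: kl; rewrite ?(e6 V.l isT) ?(e6 V.N isT) ?(e6 V.m isT) ?(e6 V.r isT).
(* Counting the nodes takes time linear in r, which the main term absorbs as l, m and N are
   positive. *)
have hr : r.+1 <= l * (m * (N * cube)).
  rewrite -[leqLHS]mul1n; apply: leq_mul; first by rewrite lt0n.
  rewrite -[leqLHS]mul1n; apply: leq_mul => //.
  rewrite -[leqLHS]mul1n; apply: leq_mul => //.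
  by rewrite /cube -mulnA leq_pmulr.
have -> : size (comp_expr (Var V.l0) tmp) = 2 by [].
move: cP k1 k2 q2 q5 q3 q6 hr.
move: (l * _) (cost prelude g) (cost short_params S1) (cost long_params S4) => z a1 a2 a3.
move: (cost count_nodes S2) (cost count_nodes S5) (cost layers S3) (cost layers S6) (r) => a4 a5 a6 a7 x.
by clear; lia.
Qed.

End Algorithm.

(** * Instances of Locally Rainbow Walk *)

Definition separated (r : nat) (cs : seq nat) : Prop :=
  forall i j, i < j < size cs -> j <= i + r -> nth 0 cs i != nth 0 cs j.

Lemma separated_rcons r cs c : separated r (rcons cs c) <->
  separated r cs /\ forall i, i < size cs -> i < r -> nth 0 (rev cs) i != c.
Proof.
split=> [H|[H1 H2] i j].
  split=> [i j /andP[h1 h2] hr|i hi hr].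
    have := H i j; rewrite size_rcons !nth_rcons h2 (ltn_trans h1 h2).
    by apply; [rewrite h1 ltnW|].
  have := H (size cs - i.+1) (size cs); rewrite nth_rev // size_rcons !nth_rcons ltnn eqxx.
  by case: ifP => [_|]; [apply; lia|lia].
rewrite size_rcons ltnS => /andP[h1 h2] hr; rewrite !nth_rcons (leq_trans h1 h2).
move: h2; rewrite leq_eqVlt => /orP[/eqP e|h2]; last first.
  by rewrite h2; apply: H1 => //; rewrite h1.
rewrite e ltnn eqxx; rewrite e in h1 hr.
have := H2 (size cs - i.+1); rewrite nth_rev; last lia.
have -> : size cs - (size cs - i.+1).+1 = i by lia.
by apply; lia.
Qed.

Section Instance.

Variables (I : lrw_instance) (e : seq (vertex (graph I) * vertex (graph I))).
Hypothesis eP : perm_eq e (enum (arcs (graph I))).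

Let G := graph I.
Let inp a := nth 0 (lrw_encode e) a.
Let n := nvert G.
Let m := #|arcs G|.
Let eu k := inp (6 + n + (k + k)).
Let ev k := inp (7 + n + (k + k)).
Let col x := inp (5 + x).

Let size_e : size e = m.
Proof. by rewrite (perm_size eP) -cardE. Qed.

Lemma nth_flatten_pairs (T : Type) (f g : T -> nat) (x : T) (s : seq T) k :
  k < size s ->
  nth 0 (flatten [seq [:: f a; g a] | a <- s]) (k + k) = f (nth x s k) /\
  nth 0 (flatten [seq [:: f a; g a] | a <- s]) (k + k).+1 = g (nth x s k).
Proof.
elim: s k => [|a s IH] [|k] //= hk; rewrite addnS /=; exact: IH.
Qed.

Lemma nth_encode k : inp (6 + k) =
  nth 0 ([seq color v | v <- enum 'I_(nvert G)] ++
         flatten [seq [:: val a.1; val a.2] | a <- e]) k.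
Proof. by []. Qed.

Lemma encode_color (v : vertex G) : col v.+1 = color v.
Proof.
rewrite /col -[5 + v.+1]/(6 + v) nth_encode nth_cat size_map size_enum_ord ltn_ord.
by rewrite (nth_map v) ?size_enum_ord // nth_ord_enum.
Qed.

Lemma encode_arc k (x : vertex G * vertex G) : k < m ->
  eu k = val (nth x e k).1 /\ ev k = val (nth x e k).2.
Proof.
rewrite -size_e => hk; rewrite /eu /ev.
have -> : 6 + n + (k + k) = 6 + (n + (k + k)) by lia.
have -> : 7 + n + (k + k) = 6 + (n + (k + k)).+1 by lia.
rewrite !nth_encode.
have sz : size [seq color v | v <- enum 'I_(nvert G)] = n by rewrite size_map size_enum_ord.
rewrite !nth_cat sz.
have -> : (n + (k + k) < n) = false by lia.
have -> : ((n + (k + k)).+1 < n) = false by lia.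
rewrite subSn ?leq_addr // !addKn.
exact: nth_flatten_pairs.
Qed.

Lemma encode_high y : 6 + n + m + m <= y -> inp y = 0.
Proof.
move=> hy; apply: nth_default; rewrite !size_cat size_map size_enum_ord /= -/n.
have -> : size (flatten [seq [:: val a.1; val a.2] | a <- e]) = m + m.
  rewrite -size_e; elim: (e) => //= a s ->; lia.
lia.
Qed.

Lemma arc_lt k : k < m -> eu k < n /\ ev k < n.
Proof.
case e0 : e => [|x e']; first by rewrite -size_e e0.
by move=> hk; have [-> ->] := encode_arc x hk; rewrite !ltn_ord.
Qed.

Lemma arc_pair k : k < m -> exists u v : vertex G, [/\ Defs.arc u v, eu k = u & ev k = v].
Proof.
move=> hk; case e0 : e => [|x e']; first by move: hk; rewrite -size_e e0.
have [-> ->] := encode_arc x hk; exists (nth x e k).1, (nth x e k).2; split=> //.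
by rewrite /Defs.arc -surjective_pairing -mem_enum -(perm_mem eP) mem_nth // size_e.
Qed.

Lemma arc_index (u v : vertex G) : Defs.arc u v -> exists k, [/\ k < m, eu k = u & ev k = v].
Proof.
rewrite /Defs.arc -mem_enum -(perm_mem eP) => h; exists (index (u, v) e).
have hk : index (u, v) e < m by rewrite -size_e index_mem.
by have [-> ->] := encode_arc (u, v) hk; rewrite nth_index.
Qed.

Definition history (v : vertex G) (p : seq (vertex G)) : seq nat :=
  rev [seq (val x).+1 | x <- v :: p].

Lemma history_color v p i : i < size (v :: p) ->
  col (nth 0 (history v p) i) = nth 0 (rev [seq color x | x <- v :: p]) i.
Proof.
move=> hi; rewrite /history -!map_rev !(nth_map v) ?size_rev //; exact: encode_color.
Qed.

Lemma valid_path r q v h : valid r col m (source I) eu ev q v h ->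
  exists p, [/\ path (@Defs.arc G) (source I) p, val (last (source I) p) = v, size p = q,
    h = history (source I) p & separated r [seq color x | x <- source I :: p]].
Proof.
elim=> [|{}q k {}h hk _ [p [hp hl hs -> hsep]] hx].
  by exists [::]; split=> // i j /= /andP[h1 h2]; lia.
have [u [w [huw eu_k ev_k]]] := arc_pair hk.
exists (rcons p w); split.
- by rewrite rcons_path hp /=; move: hl; rewrite eu_k => /val_inj->.
- by rewrite last_rcons.
- by rewrite size_rcons hs.
- by rewrite /history -rcons_cons map_rcons rev_rcons ev_k.
- rewrite -rcons_cons map_rcons separated_rcons; split=> // i; rewrite size_map => hi hir.
  have := hx i hir; rewrite size_rev size_map => /(_ hi).
  by rewrite history_color // ev_k encode_color.
Qed.

Lemma path_valid r p : path (@Defs.arc G) (source I) p ->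
  separated r [seq color x | x <- source I :: p] ->
  valid r col m (source I) eu ev (size p) (last (source I) p) (history (source I) p).
Proof.
elim/last_ind: p => [|p w IH]; first by move=> _ _; exact: valid0.
rewrite rcons_path -rcons_cons map_rcons separated_rcons => /andP[hp ha] [hsep hx].
have [k [hk eu_k ev_k]] := arc_index ha.
rewrite size_rcons last_rcons /history -rcons_cons map_rcons rev_rcons -[\val w]/(nat_of_ord w) -ev_k.
apply: validS => //; first by rewrite eu_k; apply: IH.
move=> i hir; rewrite size_rev size_map => hi.
rewrite ev_k encode_color history_color //; apply: hx => //; by rewrite size_map.
Qed.

(** In a walk of length at least r, any two positions at distance at most r lie in a common block of
    r + 1 vertices. *)
Lemma separated_rainbow r v p : r <= size p ->
  rainbow (@color I) r v p <-> separated r [seq color x | x <- v :: p].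
Proof.
move=> hr; rewrite /rainbow; set s := v :: p; set cs := map _ s.
have sz : size cs = (size p).+1 by rewrite size_map.
have tE i : [seq color u | u <- take r.+1 (drop i s)] = take r.+1 (drop i cs).
  by rewrite map_take map_drop.
have szt i : i + r <= size p -> size (take r.+1 (drop i cs)) = r.+1.
  by move=> hi; rewrite size_takel // size_drop sz; lia.
split=> H.
  move=> i j; rewrite sz => /andP[h1 h2] h3.
  (* The block starts at [i], or earlier if it would extend beyond the end of the walk. *)
  pose i0 := minn i (size p - r).
  have hi0 : i0 + r <= size p by rewrite /i0; lia.
  have := H i0 hi0; rewrite tE => hu.
  have := nth_uniq 0 (_ : i - i0 < size _) (_ : j - i0 < size _) hu.
  rewrite szt // !nth_take; try (rewrite /i0; lia).
  rewrite !nth_drop !subnKC; try (rewrite /i0; lia).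
  by move=> ->; rewrite /i0; lia.
move=> i hi; rewrite tE; apply/(uniqP 0) => j k; rewrite !inE szt // => hj hk.
rewrite !nth_take // !nth_drop => ejk.
have [lt|lt|//] := ltngtP j k.
  by have := H (i + j) (i + k); rewrite ejk eqxx sz => h; have := h ltac:(lia) ltac:(lia).
by have := H (i + k) (i + j); rewrite ejk eqxx sz => h; have := h ltac:(lia) ltac:(lia).
Qed.

Lemma separated0 cs : separated 0 cs.
Proof. by move=> i j; lia. Qed.

(** Walks shorter than r are vacuously rainbow, and [separated] with parameter 0 imposes nothing on
    them either. Length 0 is excluded by s != t. *)
Lemma lrw_yesE : lrw_yes I <->
  (exists q h, 0 < q <= minn (maxlen I) (rainbow_param I - 1) /\
     valid 0 col m (source I) eu ev q (target I) h) \/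
  (exists q h, 0 < q <= maxlen I /\
     valid (rainbow_param I) col m (source I) eu ev q (target I) h).
Proof.
split=> [[p [[hp hl] hr hs]]|].
  have p0 : 0 < size p.
    by case: p hl {hp hr hs} => //= e0; have := source_target I; rewrite e0 eqxx.
  rewrite -hl; have [h|h] := ltnP (size p) (rainbow_param I).
    left; exists (size p), (history (source I) p); split; first lia.
    by apply: path_valid => //; exact: separated0.
  right; exists (size p), (history (source I) p); split; first by rewrite p0.
  by apply: path_valid => //; apply/separated_rainbow.
case=> -[q [h [hq /valid_path[p [hp /val_inj hl hs _ hsep]]]]].
  exists p; split=> //; last by rewrite hs; lia.
  move=> i hi; have hi' : i + rainbow_param I <= q by rewrite -hs.
  by exfalso; lia.
exists p; split=> //; last by rewrite hs; case/andP: hq.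
have [lt|le] := ltnP (size p) (rainbow_param I); last by apply/separated_rainbow.
by move=> i hi; have := leq_trans lt (leq_trans (leq_addl i _) hi); rewrite ltnn.
Qed.

(** Without arcs the time bound would be constant even for l > 0. *)
Lemma arcs_gt0 : weakly_connected (graph I) -> 0 < m.
Proof.
move=> /(_ (source I) (target I))/connectP[[|x p]] /=.
  by move=> _ e0; have := source_target I; rewrite e0 eqxx.
by move=> /andP[/orP[] h _] _; apply/card_gt0P; eexists; exact: h.
Qed.

End Instance.

Lemma decides_in_weaken K K' P inp yes t : K <= K' ->
  decides_in K P inp yes t -> decides_in K' P inp yes t.
Proof.
move=> hK [h1 h2 h3]; split=> // k a hk; have [b1 b2] := h3 k a hk.
by split; [apply: leq_trans b1 _|apply: leq_trans b2 _]; rewrite leq_pexp2l.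
Qed.

Lemma tree_size_le r k : 0 < r -> tree_size r k.+1 <= k.+1 * (r * r) ^ k.
Proof.
move=> r0; elim: k => [|k IH]; first by rewrite expn0.
rewrite -[tree_size r k.+2]/(tree_size r k.+1 * (r * r) + 1) expnSr mulSn addnC.
apply: leq_add; first by rewrite muln_gt0 expn_gt0 muln_gt0 r0.
by rewrite (mulnA k.+1) leq_mul2r IH orbT.
Qed.


Local Open Scope ring_scope.

(** * The matrix multiplication exponent *)

Lemma slp_eval_cat (F : fieldType) (L : comAlgType F) (vs : seq L) (p q : slp F) :
  slp_eval vs (p ++ q) = slp_eval (slp_eval vs p) q.
Proof. exact: foldl_cat. Qed.

Lemma size_slp_eval (F : fieldType) (L : comAlgType F) (vs : seq L) (p : slp F) :
  size (slp_eval vs p) = (size vs + size p)%N.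
Proof.
elim: p vs => [|o p IH] vs /=; first by rewrite addn0.
by rewrite IH size_rcons addnS.
Qed.

Lemma nth_slp_eval (F : fieldType) (L : comAlgType F) (vs : seq L) (p : slp F) k :
  (k < size vs)%N -> (slp_eval vs p)`_k = vs`_k.
Proof.
elim: p vs => [|o p IH] vs hk //=.
by rewrite IH ?size_rcons ?ltnS 1?ltnW // nth_rcons hk.
Qed.

Definition mx_index (n : nat) : seq ('I_n * 'I_n) :=
  [seq (i, j) | i <- enum 'I_n, j <- enum 'I_n].

Lemma mx_entriesE (T : Type) n (A : 'M[T]_n) :
  mx_entries A = [seq A x.1 x.2 | x <- mx_index n].
Proof. by rewrite /mx_entries /mx_index map_allpairs. Qed.

Lemma mem_mx_index n (x : 'I_n * 'I_n) : x \in mx_index n.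
Proof. by case: x => i j; apply/allpairsP; exists (i, j); rewrite !mem_enum. Qed.

Lemma size_mx_index n : size (mx_index n) = (n * n)%N.
Proof. by rewrite size_allpairs size_enum_ord. Qed.

Lemma size_mx_entries (T : Type) n (A : 'M[T]_n) : size (mx_entries A) = (n * n)%N.
Proof. by rewrite mx_entriesE size_map size_mx_index. Qed.

Lemma index_mx_lt n (x : 'I_n * 'I_n) : (index x (mx_index n) < n * n)%N.
Proof. by rewrite -size_mx_index index_mem mem_mx_index. Qed.

Lemma nth_mx_entries (T : Type) (d : T) n (A : 'M[T]_n) (x : 'I_n * 'I_n) :
  nth d (mx_entries A) (index x (mx_index n)) = A x.1 x.2.
Proof.
rewrite mx_entriesE (nth_map x) ?size_mx_index ?index_mx_lt //.
by rewrite nth_index ?mem_mx_index.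
Qed.

(** * The naive matrix product *)

Section NaiveProduct.

Variables (F : fieldType) (n : nat).

Let ins (L : comAlgType F) (A B : 'M[L]_n) := mx_entries A ++ mx_entries B.

Let size_ins (L : comAlgType F) (A B : 'M[L]_n) : size (ins A B) = (n * n + n * n)%N.
Proof. by rewrite size_cat !size_mx_entries. Qed.

(** Instructions refer to absolute positions, so the code is built behind the part [p0] already
    written. It consists of a zero followed by a product and a sum per term. *)
Lemma slp_dot_product (p0 : slp F) (i j : 'I_n) (l : seq 'I_n) :
  exists (p : slp F) (z : nat),
    [/\ size p = (1 + 2 * size l)%N, (z < n * n + n * n + size (p0 ++ p))%N
      & forall (L : comAlgType F) (A B : 'M[L]_n),
          (slp_eval (ins A B) (p0 ++ p))`_z = \sum_(k <- l) A i k * B k j].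
Proof.
elim: l => [|k l [p [z [hs ho H]]]].
  exists [:: ACst 0], (n * n + n * n + size p0)%N; split=> //.
    by rewrite size_cat addn1 addnS.
  move=> L A B; rewrite slp_eval_cat big_nil /= nth_rcons size_slp_eval size_ins.
  by rewrite ltnn eqxx scale0r.
set N := (n * n + n * n + size (p0 ++ p))%N in ho.
pose a := index (i, k) (mx_index n); pose b := (n * n + index (k, j) (mx_index n))%N.
exists (p ++ [:: @AMul F a b; @AAdd F z N]), N.+1; split.
- by rewrite size_cat hs /=; lia.
- by rewrite catA size_cat /= /N; lia.
move=> L A B; rewrite catA slp_eval_cat /=.
set vs := slp_eval _ _; have svs : size vs = N by rewrite size_slp_eval size_ins.
have ha : vs`_a = A i k.
  rewrite nth_slp_eval ?size_ins; last by rewrite ltn_addr // index_mx_lt.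
  by rewrite nth_cat size_mx_entries index_mx_lt nth_mx_entries.
have hb : vs`_b = B k j.
  rewrite nth_slp_eval ?size_ins; last by rewrite /b ltn_add2l index_mx_lt.
  by rewrite nth_cat size_mx_entries /b ltnNge leq_addr /= addKn nth_mx_entries.
rewrite nth_rcons size_rcons svs ltnn eqxx !nth_rcons svs ho ltnn eqxx ha hb H.
by rewrite big_cons addrC.
Qed.

Lemma slp_products (l : seq ('I_n * 'I_n)) :
  exists (p : slp F) (out : 'I_n * 'I_n -> nat),
    size p = (size l * (1 + 2 * n))%N /\
    forall x, x \in l -> (out x < n * n + n * n + size p)%N /\
      forall (L : comAlgType F) (A B : 'M[L]_n),
        (slp_eval (ins A B) p)`_(out x) = (A *m B) x.1 x.2.
Proof.
elim: l => [|[i j] l [p0 [ out [hs H]]]]; first by exists [::], (fun=> 0%N).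
have [p [z [hsp hz Hp]]] := slp_dot_product p0 i j (index_enum 'I_n).
exists (p0 ++ p), (fun x => if x == (i, j) then z else out x); split.
  by rewrite size_cat hs hsp /= mulSn addnC -[index_enum _]enumT size_enum_ord.
move=> x; rewrite inE; case: eqP => [-> _|_ /= /H[h1 h2]].
  by split=> // L A B; rewrite Hp mxE.
split; first by apply: leq_trans h1 _; rewrite leq_add2l size_cat leq_addr.
by move=> L A B; rewrite slp_eval_cat nth_slp_eval ?h2 // size_slp_eval size_ins.
Qed.

(** Makes the set of admissible exponents nonempty, without which a lower bound says nothing about
    its infimum. *)
Lemma naive_mulmx : exists2 p : slp F, computes_mulmx n p & size p = (n * n * (1 + 2 * n))%N.
Proof.
have [p [ out [hs H]]] := slp_products (mx_index n).
exists p; last by rewrite hs size_mx_index.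
exists (fun i j => out (i, j)) => L A B i j.
by have [_ ->] := H (i, j) (mem_mx_index _).
Qed.

End NaiveProduct.

(* The n^2 entries of the product are pairwise different and none of them is an
   entry of a factor, so each of them needs an instruction of its own. *)
Lemma computes_mulmx_size (F : fieldType) n (p : slp F) :
  computes_mulmx n p -> (n * n <= size p)%N.
Proof.
move=> [ out H].
(* The product E_ii E_ij = E_ij has a single nonzero entry, which tells the outputs apart. It also
   shows that each output position exists, as the default value is 0. *)
have Hd (i j : 'I_n) : (slp_eval (mx_entries (delta_mx i i : 'M[F^o]_n) ++ mx_entries (delta_mx i j)) p)`_(out i j) = 1.
  by rewrite H mul_delta_mx mxE !eqxx.
have inj (x y : 'I_n * 'I_n) : out x.1 x.2 = out y.1 y.2 -> x = y.
  case: x y => [i j] [i' j'] /= e; have := Hd i j; rewrite e H mul_delta_mx mxE.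
  by case: eqP => [->|_]; case: eqP => [->|_] //= /eqP; rewrite eq_sym oner_eq0.
have lt i j : (out i j < n * n + n * n + size p)%N.
  rewrite ltnNge; apply/negP => h; have := Hd i j; rewrite nth_default.
    by move/eqP; rewrite eq_sym oner_eq0.
  by rewrite size_slp_eval size_cat !size_mx_entries.
have const1 k : (k < n * n)%N -> (mx_entries (const_mx 1 : 'M[F^o]_n))`_k = 1.
  move=> hk; rewrite mx_entriesE.
  have [x0 _] : exists x : 'I_n * 'I_n, True.
    by case: n hk {H Hd inj lt out} => // n' _; exists (ord0, ord0).
  by rewrite (nth_map x0) ?size_mx_index // mxE.
(* If one factor is 0 and the other consists of ones, all outputs are 0, so none of them can be an
   entry of the latter. *)
have ge i j : (n * n + n * n <= out i j)%N.
  rewrite leqNgt; apply/negP => h.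
  have [h1|h1] := ltnP (out i j) (n * n).
    have := H F^o (const_mx 1) 0 i j; rewrite mulmx0 mxE nth_slp_eval; last first.
      by rewrite size_cat !size_mx_entries.
    rewrite nth_cat size_mx_entries h1 const1 //.
    by move/eqP; rewrite oner_eq0.
  have := H F^o 0 (const_mx 1) i j; rewrite mul0mx mxE nth_slp_eval; last first.
    by rewrite size_cat !size_mx_entries.
  rewrite nth_cat size_mx_entries ltnNge h1 /= const1; last by rewrite ltn_subLR.
  by move/eqP; rewrite oner_eq0.
pose s := [seq (out x.1 x.2 - (n * n + n * n))%N | x <- enum {: 'I_n * 'I_n}].
have <- : size s = (n * n)%N by rewrite size_map -cardE card_prod card_ord.
rewrite -(size_iota 0 (size p)); apply: uniq_leq_size.
  rewrite map_inj_uniq ?enum_uniq // => x y e; apply: inj.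
  by have := ge x.1 x.2; have := ge y.1 y.2; move: e => /=; lia.
move=> k /mapP[x _ ->]; rewrite mem_iota add0n ltn_subLR //; exact: lt.
Qed.

Lemma natr_powR_unbounded (R : realType) (d K : R) : 0 < d ->
  exists2 n : nat, (0 < n)%N & K < n%:R `^ d.
Proof.
move=> d0; pose x := (`|K| + 1) `^ d^-1.
have K0 : 0 <= `|K| + 1 by rewrite addr_ge0.
have x0 : 0 <= x by exact: powR_ge0.
have hx := archi_boundP x0.
exists (Num.bound x); first by rewrite -(ltr_nat R) (le_lt_trans x0).
have : x `^ d <= (Num.bound x)%:R `^ d.
  by apply: ge0_ler_powR; rewrite ?nnegrE ?ler0n ?(ltW d0) ?(ltW hx) //.
rewrite -powRrM mulVf ?gt_eqF // powRr1 //; apply: lt_le_trans.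
by rewrite (le_lt_trans (ler_norm K)) // ltrDl.
Qed.

(** If tau < 2, then n^2 <= K n^tau would bound n^(2 - tau) by K for all n. *)
Lemma mulmx_exponent_ge2 (R : realType) (F : fieldType) : 2 <= mulmx_exponent R F.
Proof.
apply: lb_le_inf.
  (* The naive product needs n^2 (1 + 2 n) <= 3 n^3 instructions. *)
  exists 3, 3 => n n0; have [p hp hs] := naive_mulmx F n; exists p => //.
  rewrite (powR_mulrn 3) ?ler0n // hs -natrX -natrM ler_nat.
  by rewrite expnS expnS expn1; nia.
move=> tau [K HK]; rewrite leNgt; apply/negP => ht.
have [n n0 hn] := @natr_powR_unbounded R (2 - tau) K (ltac:(by rewrite subr_gt0)).
have [p /computes_mulmx_size hp hs] := HK n n0.
have : n%:R `^ 2 <= K * n%:R `^ tau.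
  apply: le_trans hs; rewrite (powR_mulrn 2) ?ler0n // -natrX ler_nat.
  by rewrite -mulnn.
have -> : (2 : R) = tau + (2 - tau) by lra.
have n0' : n%:R != 0 :> R by rewrite pnatr_eq0 -lt0n.
rewrite powRD; last by rewrite n0' implybT.
rewrite mulrC ler_pM2r; last by rewrite powR_gt0 // ltr0n.
by rewrite leNgt hn.
Qed.

(** For r > 0 the left side is at most r^(2 r) (r + 1)^4, and r + 1 <= 2 (1 + r / 2) <= 2 e^(r / 2)
    yields (r + 1)^4 <= 16 e^(2 r). Enlarging the exponent 2 to omega is allowed because r e >=
    1. *)
Lemma running_time_bound (R : realType) (omega : R) (r : nat) : 2 <= omega ->
  (tree_size r r.+1 * (r.+1 * r.+1 * r.+1))%:R
    <= 16 * (r%:R * expR 1) `^ (omega * r%:R) :> R.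
Proof.
move=> homega; case: (posnP r) => [->|r0].
  by rewrite mulr0 powRr0 mulr1 ler_nat.
have r1 : 1 <= r%:R :> R by rewrite ler1n.
have e1 : 1 <= expR 1 :> R by rewrite -expR0 ler_expR.
have b1 : 1 <= r%:R * expR 1 :> R by apply: mulr_ege1.
apply: (@le_trans _ _ (16 * (r%:R * expR 1) `^ (2 * r%:R))); last first.
  by rewrite ler_pM2l ?ltr0n // ler_powR // ler_pM2r ?ltr0n.
have -> : (r%:R * expR 1) `^ (2 * r%:R) = ((r * r) ^ r)%:R * expR (r%:R / 2) ^+ 4 :> R.
  have b0 : 0 <= r%:R * expR 1 :> R := le_trans ler01 b1.
  rewrite -natrM powR_mulrn // exprMn -natrX mulnn -expnM; congr (_ * _).
  rewrite -!expRM_natl; congr expR; rewrite natrM; lra.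
have h1 : (tree_size r r.+1)%:R <= r.+1%:R * ((r * r) ^ r)%:R :> R.
  by rewrite -natrM ler_nat tree_size_le.
have h2 : r.+1%:R ^+ 4 <= 16 * expR (r%:R / 2) ^+ 4 :> R.
  have -> : 16 = 2 ^+ 4 :> R by rewrite -natrX.
  rewrite -exprMn lerXn2r ?nnegrE ?ler0n ?mulr_ge0 ?expR_ge0 //.
  have : r%:R + 1 = r.+1%:R :> R by rewrite natr1.
  have := expR_ge1Dx (r%:R / 2 : R); lra.
have h3 : 0 <= ((r * r) ^ r)%:R :> R by rewrite ler0n.
have h4 : 0 <= r.+1%:R ^+ 3 :> R by rewrite exprn_ge0.
have := ler_wpM2r h4 h1; have := ler_wpM2l h3 h2.
rewrite !natrM; move: (tree_size _ _)%:R ((r * r) ^ r)%:R (expR _ ^+ 4) (r.+1%:R) => a b c d.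
by move=> *; apply: (@le_trans _ _ (d * b * d ^+ 3)); lra.
Qed.

Theorem theorem1 (R : realType) (F : fieldType) :
  exists (P : program) (K : nat),
    forall (I : lrw_instance) (e : seq (vertex (graph I) * vertex (graph I))),
      weakly_connected (graph I) ->
      perm_eq e (enum (arcs (graph I))) ->
      exists t : nat,
        decides_in K P (lrw_encode e) (lrw_yes I) t /\
        t%:R <= K%:R * lrw_bound (mulmx_exponent R F) I.
Proof.
(* The same [K] is the exponent of the word bound, where 60 suffices, and the factor of the time
   bound: 3000 from [algorithm_cost], 16 from [running_time_bound]. *)
exists (compile algorithm 0), (3000 * 16)%N => I e hconn he.
pose r := rainbow_param I; pose l := maxlen I; pose m := #|arcs (graph I)|.
pose N := tree_size r r.+1.
pose B := (l * (m * (N * (r.+1 * r.+1 * r.+1))))%N.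
exists (3000 * (1 + B))%N; split.
  have m0 := arcs_gt0 hconn.
  have inp_le y : (nth 0%N (lrw_encode e) y <= sumn (lrw_encode e))%N.
    elim: (lrw_encode e) y => [|x s IH] [|y] //=; first exact: leq_addr.
    by apply: leq_trans (IH y) _; apply: leq_addl.
  have eu_lt k (hk : (k < m)%N) := (arc_lt he hk).1.
  have ev_lt k (hk : (k < m)%N) := (arc_lt he hk).2.
  have s_lt := ltn_ord (source I); have t_lt := ltn_ord (target I).
  have high := encode_high he.
  apply: (@decides_in_weaken 60) => //; apply: compile_decides => //.
  - apply: algorithm_safe => //.
      by move=> y; apply: leq_trans (inp_le y) _; apply: leq_addl.
    (* The number of nodes is at most the time [t], which enters the word bound. *)
    move=> l0; apply: (@leq_trans B); last lia.
    rewrite -[leqLHS]mul1n; apply: leq_mul; first by rewrite lt0n.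
    rewrite -[leqLHS]mul1n; apply: leq_mul => //.
    by rewrite leq_pmulr.
  - exact: algorithm_cost.
  - by rewrite lrw_yesE; first exact: algorithmE.
rewrite /lrw_bound -/r -/l -/m.
have := running_time_bound r (mulmx_exponent_ge2 R F).
set p := _ `^ _ => h.
have hlm : 0 <= l%:R * m%:R :> R by rewrite mulr_ge0.
have hB : B%:R <= 16 * p * (l%:R * m%:R) :> R.
  apply: le_trans (ler_wpM2r hlm h); rewrite -!natrM ler_nat /B.
  by rewrite mulnA mulnC.
have hp : 0 <= p * (l%:R * m%:R) by rewrite mulr_ge0 ?powR_ge0.
rewrite natrM (natrM _ 3000 16) natrD -mulrA ler_pM2l ?ltr0n //.
by lra.
Qed.
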